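(* Let $\Gamma\subset SL(2,\mathbb Z)$ be a normal subgroup of finite index, and let $(\lambda,\delta)\in\mathbb C\times\mathbb Z/2\mathbb Z$ satisfy either $\lambda\in i\mathbb R$ (with $\delta=0$ or $\delta=1$), or $\delta=0$ and $\lambda\in(-1,0)\cup(0,1)$. Let $\tau\in(V_{\lambda,\delta}^{-\infty})^\Gamma$ be a $\Gamma$-automorphic distribution satisfying the natural extension condition (see context), and let $\phi_\tau$ be its normalized continuous antiderivative. Let $p,q$ be coprime integers with $q>0$, choose $r,s\in\mathbb Z$ with $pr-qs=1$, put $\gamma=\begin{pmatrix}r&-s\\-q&p\end{pmatrix}\in SL(2,\mathbb Z)$, and let $c_{\gamma\tau,0}$ be the constant Fourier coefficient of $\pi_{\lambda,\delta}(\gamma)\tau$. Suppose $\tau$ does not vanish identically. Then $\operatorname{Re}\phi_\tau(x)$ and $\operatorname{Im}\phi_\tau(x)$ fail to be differentiable at $x=p/q$, except in the following situation: $\lambda>0$ and $\operatorname{Re}c_{\gamma\tau,0}=0$, respectively $\lambda>0$ and $\operatorname{Im}c_{\gamma\tau,0}=0$. When that is the case, the derivative exists and $\operatorname{Re}\phi_\tau'(p/q)=-\operatorname{Re}c_{\tau,0}$, respectively $\operatorname{Im}\phi_\tau'(p/q)=-\operatorname{Im}c_{\tau,0}$. In particular, if $\lambda>0$ and if $\tau$ is cuspidal, $\phi_\tau(x)$ is differentiable at all rational points, with derivative $0$.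
   Context: Notation: $G=SL(2,\mathbb R)$, $e(x)=e^{2\pi i x}$. $C^{-\infty}(\mathbb R)$ is the space of complex-valued distributions on $\mathbb R$, dual to compactly supported smooth measures, so that distributions transform like functions. The space $V_{\lambda,\delta}^{-\infty}$: pairs $(\tau,\tilde\tau)\in C^{-\infty}(\mathbb R)\times C^{-\infty}(\mathbb R)$ such that $\tilde\tau(x)=(\operatorname{sgn}x)^\delta|x|^{\lambda-1}\tau(-1/x)$ for $x\ne0$. A pair is denoted by its first member $\tau$. The group $G$ acts on it by $\pi_{\lambda,\delta}$: for $g^{-1}=\begin{pmatrix}a&b\\c&d\end{pmatrix}$, the first member of $\pi_{\lambda,\delta}(g)(\tau,\tilde\tau)$ is $$(\pi_{\lambda,\delta}(g)\tau)(x)=(\operatorname{sgn}(cx+d))^\delta|cx+d|^{\lambda-1}\tau\Bigl(\frac{ax+b}{cx+d}\Bigr)\quad\text{where }cx+d\neq0,$$ and equals $(\operatorname{sgn}(-(ax+b)))^\delta|ax+b|^{\lambda-1}\tilde\tau\bigl(-\frac{cx+d}{ax+b}\bigr)$ where $ax+b\ne0$ (the two expressions agree on the overlap). The second member of $\pi_{\lambda,\delta}(g)(\tau,\tilde\tau)$ is the first member of $\pi_{\lambda,\delta}(wg)(\tau,\tilde\tau)$, where $w^{-1}=\begin{pmatrix}0&-1\\1&0\end{pmatrix}$. $(V_{\lambda,\delta}^{-\infty})^\Gamma$ denotes the space of $\Gamma$-invariants, called $\Gamma$-automorphic distributions. Let $N\ge1$ be the integer such that $\begin{pmatrix}1&n\\0&1\end{pmatrix}\in\Gamma\iff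 N\mid n$. Each $\tau\in(V_{\lambda,\delta}^{-\infty})^\Gamma$ is periodic of period $N$, with Fourier series $\tau(x)=c_{\tau,0}+\sum_{n\ne0}c_n e(nx/N)$. Since $\Gamma$ is normal, the same applies to all translates $\pi_{\lambda,\delta}(\gamma)\tau$, $\gamma\in SL(2,\mathbb Z)$, whose constant coefficient is denoted $c_{\gamma\tau,0}$. Natural extension condition: for $\tau$ and for each translate $\pi_{\lambda,\delta}(\gamma)\tau$, $\gamma\in SL(2,\mathbb Z)$ (in place of $\tau$): (i) the constant Fourier coefficient is $0$ unless $\operatorname{Re}\lambda>0$; and (ii) the distribution $\tilde\tau$ on all of $\mathbb R$ equals the sum of the locally integrable function $c_{\tau,0}(\operatorname{sgn}x)^\delta|x|^{\lambda-1}$ (which is absent if $c_{\tau,0}=0$) and the canonical extension across $x=0$ of $(\operatorname{sgn}x)^\delta|x|^{\lambda-1}\sum_{n\neq0}c_ne(-n/(Nx))$. Here the canonical extension is the unique extension $f$ which vanishes to infinite order at $0$, i.e. such that for each $m\ge0$, on some neighborhood of $0$, $f=x^m\sum_{j=0}^{J}x^j\frac{d^j}{dx^j}h_j$ with finitely many bounded measurable functions $h_j$; it is obtained by repeated integration by parts. Moreover $\tau$ is not a nonzero constant with $(\lambda,\delta)=(1,0)$. $\tau$ is cuspidal if $c_{\gamma\tau,0}=0$ for all $\gamma\in SL(2,\mathbb Z)$. Antiderivative: under these hypotheses on $\tau$ and $(\lambda,\delta)$ it is known (an earlier result of Schmid) that $\tau$ has a continuous antiderivative; $\phi_\tau$ denotes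 the unique continuous function, periodic of period $N$, with $\tau=c_{\tau,0}+\phi_\tau'$ (as distributions) and $\int_0^N\phi_\tau(x)\,dx=0$.
   Formalization: Non-differentiability of Re φ_τ (resp. Im φ_τ) is claimed only when it is not the case that λ is real with λ ≤ 0 and Re τ = 0 (resp. Im τ = 0); in that case Re φ_τ (resp. Im φ_τ) is constant, so the printed claim fails. *)

(* Defs.v *)
From HB Require Import structures.
From mathcomp Require Import all_boot all_order all_algebra.
From mathcomp Require Import all_classical all_reals all_analysis.
From mathcomp Require Import complex.

Set Implicit Arguments.
Unset Strict Implicit.
Unset Printing Implicit Defensive.

Import Order.TTheory GRing.Theory Num.Theory.
Import numFieldNormedType.Exports.

Local Open Scope classical_set_scope.
Local Open Scope ring_scope.
Local Open Scope complex_scope.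

Section ComplexValuedFunctions.
Variable R : realType.
Implicit Types (f g : R -> R[i]) (x : R).

Definition re_fun f : R -> R := fun x => complex.Re (f x).
Definition im_fun f : R -> R := fun x => complex.Im (f x).

Definition cderiven (n : nat) f : R -> R[i] :=
  fun x => derive1n n (re_fun f) x +i* derive1n n (im_fun f) x.

Definition csmooth f : Prop :=
  forall n x, derivable (derive1n n (re_fun f)) x 1 /\
              derivable (derive1n n (im_fun f)) x 1.

Definition cintegral (D : set R) f : R[i] :=
  (\int[lebesgue_measure]_(x in D) re_fun f x) +i*
  (\int[lebesgue_measure]_(x in D) im_fun f x).

Definition ccvg (u : nat -> R[i]) (l : R[i]) : Prop :=
  ((fun n => complex.Re (u n)) @ \oo --> complex.Re l) /\
  ((fun n => complex.Im (u n)) @ \oo --> complex.Im l).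

(* l = \sum_(n : int, n != 0) u n, as the limit of symmetric partial sums. *)
Definition sum_nonzero_is (u : int -> R[i]) (l : R[i]) : Prop :=
  ccvg (fun K => \sum_(1 <= k < K.+1) (u k%:Z + u (- k%:Z))) l.

(* e(x) = exp (2 pi i x) *)
Definition e2pi x : R[i] := cos (2 * pi * x) +i* sin (2 * pi * x).

(* x ^ z = exp (z ln x), meaningful for 0 < x. *)
Definition cpower x (z : R[i]) : R[i] :=
  (expR (complex.Re z * ln x))%:C *
  (cos (complex.Im z * ln x) +i* sin (complex.Im z * ln x)).

(* (sgn x)^delta |x|^(lambda - 1), meaningful for x != 0. *)
Definition weight (lambda : R[i]) (delta : 'Z_2) x : R[i] :=
  (Num.sg x ^+ delta)%:C * cpower `|x| (lambda - 1).

End ComplexValuedFunctions.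

Section Distributions.
Variable R : realType.
Implicit Types (f g : R -> R[i]) (U : set R).

Definition tsupport f : set R := closure [set x | f x != 0].

Definition test_function f : Prop := csmooth f /\ compact (tsupport f).

(* The test function f stands for the smooth measure f(x) dx.  The value of a
   functional outside the space of test functions is irrelevant: equality of
   distributions is eq_on below. *)
Definition functional := (R -> R[i]) -> R[i].
Implicit Types (S T : functional).

Definition is_distribution T : Prop :=
  (forall (a : R[i]) f g, test_function f -> test_function g ->
     T (fun x => a * f x + g x) = a * T f + T g) /\
  (forall M : R, exists (k : nat) (A : R), forall f B,
     test_function f -> tsupport f `<=` `[- M, M] ->
     (forall j x, (j <= k)%N -> `|cderiven j f x| <= B%:C) ->
     `|T f| <= (A * B)%:C).

Definition eq_on U S T : Prop :=
  forall f, test_function f -> tsupport f `<=` U -> S f = T f.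

Definition dist_of (h : R -> R[i]) : functional :=
  fun f => cintegral setT (fun x => h x * f x).

Definition dist_add S T : functional := fun f => S f + T f.

Definition dist_mul (a : R -> R[i]) T : functional :=
  fun f => T (fun x => a x * f x).

Definition dist_deriv T : functional := fun f => - T (cderiven 1 f).

(* The distribution x |-> T ((a x + b) / (c x + d)) on {x | c x + d != 0},
   where h = [a, b; c, d] has determinant 1.  With y = (a x + b) / (c x + d)
   one has x = (d y - b) / (a - c y) and dx = dy / (a - c y)^2. *)
Definition dist_moebius (h : 'M[R]_2) T : functional :=
  fun f => T (fun y =>
    ((h 0 0 - h 1 0 * y) ^- 2)%:C *
    f ((h 1 1 * y - h 0 1) / (h 0 0 - h 1 0 * y))).

(* x |-> (sgn (c x + d))^delta |c x + d|^(lambda - 1)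
           T ((a x + b) / (c x + d))  on {x | c x + d != 0} *)
Definition slash (lambda : R[i]) (delta : 'Z_2) (h : 'M[R]_2) T : functional :=
  dist_mul (fun x => weight lambda delta (h 1 0 * x + h 1 1))
           (dist_moebius h T).

End Distributions.

Definition mx2 (A : pzSemiRingType) (a b c d : A) : 'M[A]_2 :=
  \matrix_(i < 2, j < 2)
     if i == 0 then (if j == 0 then a else b)
     else (if j == 0 then c else d).

Section PrincipalSeries.
Variable R : realType.
Variables (lambda : R[i]) (delta : 'Z_2).

(* Pairs (tau, tau~). *)
Definition dist_pair := (functional R * functional R)%type.
Implicit Types (t s : dist_pair) (g : 'M[R]_2).

Definition in_V t : Prop :=
  [/\ is_distribution t.1, is_distribution t.2 &
      eq_on [set x | x != 0] t.2 (slash lambda delta (mx2 0 (-1) 1 0) t.1)].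

(* sigma is the first member of pi(g) t: the two formulas, for
   g^-1 = [a, b; c, d], on the two open sets covering the line. *)
Definition pi_first g t (sigma : functional R) : Prop :=
  let h := invmx g in
  [/\ is_distribution sigma,
      eq_on [set x | h 1 0 * x + h 1 1 != 0]
        sigma (slash lambda delta h t.1) &
      eq_on [set x | h 0 0 * x + h 0 1 != 0]
        sigma (slash lambda delta
                 (mx2 (h 1 0) (h 1 1) (- h 0 0) (- h 0 1)) t.2)].

(* s = pi(g) t; the matrix w = [0, 1; -1, 0] has inverse [0, -1; 1, 0]. *)
Definition is_pi g t s : Prop :=
  pi_first g t s.1 /\ pi_first (mx2 0 1 (-1) 0 *m g) t s.2.

End PrincipalSeries.

Definition SL2Z : set 'M[int]_2 := [set g | \det g = 1].

Definition toR (R : realType) (g : 'M[int]_2) : 'M[R]_2 :=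
  map_mx (fun n : int => n%:~R) g.

Definition normal_finite_index_subgroup (Gamma : set 'M[int]_2) : Prop :=
  [/\ Gamma `<=` SL2Z,
      Gamma 1%:M,
      forall g h, Gamma g -> Gamma h -> Gamma (g *m invmx h),
      forall g h, SL2Z g -> Gamma h -> Gamma (g *m h *m invmx g) &
      exists reps : seq 'M[int]_2, forall g, SL2Z g ->
        exists k h, [/\ k \in reps, Gamma h & g = k *m h]].

Section AutomorphicDistributions.
Variable R : realType.
Variables (Gamma : set 'M[int]_2) (N : nat).
Variables (lambda : R[i]) (delta : 'Z_2).
Implicit Types (t s : dist_pair R) (tau : functional R) (c : int -> R[i]).

Definition automorphic t : Prop :=
  in_V lambda delta t /\
  forall g, Gamma g -> is_pi lambda delta (toR R g) t t.

Definition translate (g : 'M[int]_2) t s : Prop :=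
  is_pi lambda delta (toR R g) t s.

(* tau = c 0 + \sum_(n != 0) c n * e(n x / N) *)
Definition fourier_series tau c : Prop :=
  forall f, test_function f ->
    sum_nonzero_is
      (fun n => c n * dist_of (fun x => e2pi (n%:~R * x / N%:R)) f)
      (tau f - dist_of (fun=> c 0) f).

(* F extends (sgn x)^delta |x|^(lambda - 1) \sum_(n != 0) c n * e(- n / (N x))
   from {x | x != 0} to the line. *)
Definition extends_oscillating_part c (F : functional R) : Prop :=
  is_distribution F /\
  forall f, test_function f -> tsupport f `<=` [set x | x != 0] ->
    sum_nonzero_is
      (fun n => c n * dist_of (fun x => weight lambda delta x *
                                e2pi (- n%:~R / (N%:R * x))) f)
      (F f).

Definition bounded_measurable (h : R -> R[i]) : Prop :=
  [/\ measurable_fun setT (re_fun h), measurable_fun setT (im_fun h) &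
      exists B : R, forall x, `|h x| <= B%:C].

Definition vanishes_to_infinite_order (F : functional R) : Prop :=
  forall m : nat, exists (eps : R) (J : nat) (h : nat -> R -> R[i]),
    [/\ 0 < eps, forall j, bounded_measurable (h j) &
        eq_on `]- eps, eps[ F
          (dist_mul (fun x => (x ^+ m)%:C)
             (fun f => \sum_(j < J.+1)
                dist_mul (fun x => (x ^+ j)%:C)
                  (iter j (@dist_deriv R) (dist_of (h j))) f))].

Definition natural_extension_at t : Prop :=
  exists c : int -> R[i],
    [/\ fourier_series t.1 c,
        ~ (0 < complex.Re lambda) -> c 0 = 0 &
        exists F, [/\ extends_oscillating_part c F,
          vanishes_to_infinite_order F &
          eq_on setT t.2
            (dist_add (dist_of (fun x => c 0 * weight lambda delta x)) F)]].

(* Translates and Fourier coefficients exist and are unique, so that their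
   introduction by "exists" here and in cuspidal is innocuous. *)
Definition natural_extension t : Prop :=
  (forall g, SL2Z g ->
     exists s, translate g t s /\ natural_extension_at s) /\
  ~ ([/\ lambda = 1, delta = 0 &
      exists a : R[i], a != 0 /\ eq_on setT t.1 (dist_of (fun=> a))]).

Definition cuspidal t : Prop :=
  forall g, SL2Z g -> exists s c,
    [/\ translate g t s, fourier_series s.1 c & c 0 = 0].

(* tau = c0 + phi', normalized. *)
Definition normalized_antiderivative tau (c0 : R[i]) (phi : R -> R[i]) : Prop :=
  [/\ continuous (re_fun phi) /\ continuous (im_fun phi),
      forall x, phi (x + N%:R) = phi x,
      eq_on setT tau
        (dist_add (dist_of (fun=> c0)) (dist_deriv (dist_of phi))) &
      cintegral `[0, N%:R] phi = 0].

Definition vanishes tau : Prop := eq_on setT tau (fun=> 0).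

(* The distribution Re tau (resp. Im tau) is zero. *)
Definition re_vanishes tau : Prop :=
  forall f, test_function f -> (forall x, complex.Im (f x) = 0) ->
    complex.Re (tau f) = 0.
Definition im_vanishes tau : Prop :=
  forall f, test_function f -> (forall x, complex.Im (f x) = 0) ->
    complex.Im (tau f) = 0.

End AutomorphicDistributions.

(* In R[i], z < w means that Im z = Im w and Re z < Re w. *)
Definition admissible_parameters (R : realType)
    (lambda : R[i]) (delta : 'Z_2) : Prop :=
  complex.Re lambda = 0 \/
  (delta = 0 /\ ((-1 < lambda /\ lambda < 0) \/ (0 < lambda /\ lambda < 1))).

(* Main.v *)
Require Import Defs.
From HB Require Import structures.
From mathcomp Require Import all_boot all_order all_algebra.
From mathcomp Require Import all_classical all_reals all_analysis.
From mathcomp Require Import complex ring lra.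

Set Implicit Arguments.
Unset Strict Implicit.
Unset Printing Implicit Defensive.

Import Order.TTheory GRing.Theory Num.Theory.
Import numFieldNormedType.Exports.

Local Open Scope classical_set_scope.
Local Open Scope ring_scope.

(* Write [rho y = c0 y + phi y], so that [tau = rho'].  Near the cusp [p/q] put
   [y = p/q - 1/(beta u)] with [beta = q] or [beta = -q] and [u > 0], and let
   [f u = rho y].  Invariance turns the translate of [tau] into the derivative
   of [A = u^(lam+1) f - (lam+1) J], where [J' = u^lam f]; testing its Fourier
   series against differences [B u - B (u - M)], [M = N q], of primitives of
   bumps shows that [A (u + M) - A u = M kappa] with [kappa] a multiple of the
   constant coefficient.  Hence [A = kappa u + C + Psi] with [Psi] periodic of
   mean 0, and solving back for [f], with one integration by parts of [Psi],
     u (f u - f oo) = u^(-lam) Psi u - (kappa/lam) u^(1-lam) + O(u^(-Re lam-1)).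
   The left-hand side is, up to the factor [-beta], the difference quotient of
   [rho] at [p/q], so differentiability is read off from the right-hand side.
   If it holds with [lam] real and [lam <= 0], then [Re Psi = 0] and [Re rho] is
   constant on a half-line, hence everywhere by periodicity; for imaginary
   [lam <> 0] the phase [u^(-lam)] varies slowly and forces [Psi = 0]. *)

(** With [beta = sg * q], the coordinate [u] is [sg * (q x + r)], where [x] is the variable of the
    translate; one period [N] of the translate is thus a shift of [u] by [M]. The Fourier series
    converges only in the sense of distributions, so it is never summed: against the chosen test
    functions every nonzero mode gives exactly 0, and the constant mode survives. This yields kappa
    = [sg * sg ^+ delta * cg 0 / q]. The expansion at the cusp is complex, while differentiability
    is assumed for a real or an imaginary part alone. For real lambda the powers of [u] are real and
    the two parts decouple. For nonzero imaginary lambda they mix, and differentiability of one part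
    constrains both. Imaginary parts are reduced to real ones by the factor -i. Integrals are
    handled as differences of primitives: integration by parts, shifts and changes of variable are
    checked by differentiation, a function with zero derivative being constant. *)

(** * Real calculus: mean value, fundamental theorem, primitives on the line *)

Section RealCalculus.
Variable R : realType.
Implicit Types (f g h P : R -> R) (a b x y l : R).
Local Notation mu := (@lebesgue_measure R).

Lemma is_derive_continuous f x l : is_derive x 1 f l -> {for x, continuous f}.
Proof.
by move=> [fx _]; apply/differentiable_continuous/derivable1_diffP.
Qed.

Lemma is_derive_within f (df : R -> R) a b :
  (forall x, a <= x <= b -> is_derive x 1 f (df x)) ->
  {within `[a, b], continuous f}.
Proof.
move=> fd; apply: derivable_within_continuous => x.
by rewrite in_itv/= => /fd [].
Qed.

Lemma mean_value f (df : R -> R) a b : a < b ->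
  (forall x, a <= x <= b -> is_derive x 1 f (df x)) ->
  exists2 c, a < c < b & f b - f a = df c * (b - a).
Proof.
move=> ab fd; have [x||c] := @MVT R f df a b ab.
- by rewrite in_itv/= => /andP[? ?]; apply: fd; rewrite !ltW.
- exact: is_derive_within fd.
- by rewrite in_itv/= => acb E; exists c.
Qed.

Lemma derive0_eq f a b : a <= b ->
  (forall x, a <= x <= b -> is_derive x 1 f 0) -> f a = f b.
Proof.
rewrite le_eqVlt => /orP[/eqP->//|ab] fd.
have [c _] := mean_value ab fd.
by rewrite mul0r => /eqP; rewrite subr_eq0 => /eqP.
Qed.

Lemma derive_ge0_le f (df : R -> R) a b : a <= b ->
  (forall x, a <= x <= b -> is_derive x 1 f (df x)) ->
  (forall x, a <= x <= b -> 0 <= df x) -> f a <= f b.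
Proof.
rewrite le_eqVlt => /orP[/eqP->//|ab] fd dp.
have [c /andP[ac cb] E] := mean_value ab fd.
by rewrite -subr_ge0 E mulr_ge0 ?dp ?subr_ge0 ?ltW// ac.
Qed.

Lemma Rintegral_FTC (h P : R -> R) a b : a < b ->
  (forall x, a <= x <= b -> is_derive x 1 P (h x)) ->
  (forall x, a <= x <= b -> {for x, continuous h}) ->
  (forall x, ~~ (a <= x <= b) -> h x = 0) ->
  \int[mu]_(x in setT) h x = P b - P a.
Proof.
move=> ab dP ch h0.
rewrite (_ : \int[mu]_(x in setT) h x = \int[mu]_(x in `[a, b]) h x); last first.
  rewrite [RHS]Rintegral_mkcond; apply: eq_Rintegral => x _.
  by rewrite patchE mem_setE in_itv/=; case: ifPn => // /h0.
rewrite /Rintegral (@continuous_FTC2 _ h P a b ab) //=.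
- apply: continuous_in_subspaceT => x; rewrite inE/= in_itv/=; exact: ch.
- have cP (x : R) : a <= x <= b -> {for x, continuous P}.
    by move=> /dP; exact: is_derive_continuous.
  split.
  + by move=> x; rewrite in_itv/= => /andP[ax xb]; have [] := dP x; rewrite ?(ltW ax) ?(ltW xb).
  + by apply: cvg_at_right_filter; apply: cP; rewrite lexx ltW.
  + by apply: cvg_at_left_filter; apply: cP; rewrite lexx ltW.
- move=> x; rewrite in_itv/= => /andP[ax xb]; rewrite derive1E.
  by have [] := dP x; rewrite ?(ltW ax) ?(ltW xb).
Qed.

(** The integral from [a] has the right derivative only beyond [a]; it is normalized at 0 so that
    the versions for different [a] can be glued. *)
Lemma primitive_from h a : continuous h ->
  exists P, P 0 = 0 /\ forall x, a < x -> is_derive x 1 P (h x).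
Proof.
move=> ch.
pose F x := (\int[mu]_(t in [set` `[a, x]]) (h t)).
exists (fun x => F x - F 0); split=> [|x ax]; first by rewrite subrr.
have [dF F'] : derivable F x 1 /\ derive1 F x = h x.
  have xx1 : x < x + 1 by rewrite ltrDl.
  apply: (continuous_FTC1_closed xx1 _ ax (ch x)).
  apply: continuous_compact_integrable; first exact: segment_compact.
  exact: continuous_subspaceT.
have HF : is_derive x 1 F (h x).
  by apply: (DeriveDef dF); rewrite -derive1E.
rewrite -[h x]subr0; apply: is_deriveB.
Qed.

(** Primitives on half-lines reaching further and further to the left are glued; they agree on
    common domains because all vanish at 0. *)
Lemma primitive h : continuous h -> exists P, forall x, is_derive x 1 P (h x).
Proof.
move=> ch.
have /choice[P HP] : forall n : nat, exists P, P 0 = 0 /\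
    forall x, - n.+1%:R < x -> is_derive x 1 P (h x).
  by move=> n; exact: primitive_from.
have PE (n m : nat) x : (n <= m)%N -> - n.+1%:R < x -> P n x = P m x.
  move=> nm nx.
  have nx' (t : R) : - n.+1%:R < t -> - m.+1%:R < t.
    by apply: le_lt_trans; rewrite lerN2 ler_nat.
  pose D t := P n t - P m t.
  have D0 (t : R) : - n.+1%:R < t -> is_derive t 1 D 0.
    move=> nt; rewrite -(subrr (h t)); apply: is_deriveB.
      by apply: (HP n).2.
    by apply: (HP m).2; exact: nx'.
  suff : D x = 0 by move=> /eqP; rewrite subr_eq0 => /eqP.
  have D00 : D 0 = 0 by rewrite /D (HP n).1 (HP m).1 subrr.
  have [x0|x0] := leP 0 x.
    rewrite -D00; apply/esym/derive0_eq => // t /andP[t0 _]; apply: D0.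
    by apply: lt_le_trans t0; rewrite oppr_lt0.
  rewrite -D00; apply: derive0_eq; first exact: ltW.
  by move=> t /andP[xt _]; apply: D0; exact: lt_le_trans xt.
pose F x := P (Num.truncn `|x|) x.
have bnd (x : R) : - (Num.truncn `|x|).+1%:R < x.
  rewrite ltrNl; apply: le_lt_trans (truncnS_gt _).
  by rewrite -normrN ler_norm.
exists F => x.
(* One index serves the whole unit ball around [x], so that [F] coincides with [P m] near [x]. *)
pose m := (Num.truncn (`|x| + 1)).
have mx : - m.+1%:R < x.
  rewrite ltrNl; apply: le_lt_trans (truncnS_gt _).
  by rewrite -normrN (le_trans (ler_norm _))// lerDl.
apply: near_eq_is_derive ((HP m).2 _ mx).
near=> y.
rewrite /F; apply/esym/PE; last exact: bnd.
apply: le_truncn; rewrite -lerBlDl.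
apply: le_trans (lerB_dist _ _) _.
near: y.
have := @nbhsx_ballx R R x 1 ltr01.
apply: filterS => y; rewrite /ball/= distrC => /ltW; exact.
Unshelve. all: by end_near. Qed.

End RealCalculus.

(** * Smoothness of finite and infinite order; bump functions *)

Section Smoothness.
Variable R : realType.
Implicit Types (f g : R -> R) (U V : set R) (a b x : R).

(** The recursion on the order makes closure under products, inverses and composition a plain
    induction; [smoothP] links it to [derive1n]. *)
Fixpoint Ck (n : nat) (U : set R) f : Prop :=
  if n is m.+1 then (forall x, U x -> derivable f x 1) /\ Ck m U (derive1 f)
  else True.

Lemma Ck_ext n U f g : open U -> (forall x, U x -> f x = g x) ->
  Ck n U f -> Ck n U g.
Proof.
move=> oU; elim: n f g => //= n IH f g fg [df Cf].
have nfg x : U x -> \forall y \near x, f y = g y.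
  by move=> Ux; apply: filterS (open_nbhs_nbhs (conj oU Ux)) => y; exact: fg.
split=> [x Ux|]; first exact: near_eq_derivable (nfg x Ux) (df x Ux).
apply: IH Cf => x Ux; rewrite !derive1E; exact: near_eq_derive (nfg x Ux).
Qed.

Lemma CkS n U f (df : R -> R) : open U ->
  (forall x, U x -> is_derive x 1 f (df x)) -> Ck n U df -> Ck n.+1 U f.
Proof.
move=> oU fd Cdf; split=> [x /fd []//|].
by apply: Ck_ext Cdf => // x Ux; rewrite derive1E; have [_ ->] := fd x Ux.
Qed.

Lemma CkSP n U f : Ck n.+1 U f ->
  (forall x, U x -> is_derive x 1 f (derive1 f x)) /\ Ck n U (derive1 f).
Proof.
move=> [df Cf]; split=> // x Ux.
by rewrite derive1E; apply: derivableP; exact: df.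
Qed.

Lemma CkW n U f : Ck n.+1 U f -> Ck n U f.
Proof. by elim: n f => // n IH f [df /IH]; split. Qed.

Lemma Ck_cst n U c : open U -> Ck n U (fun=> c).
Proof.
by move=> oU; elim: n c => // n IH c; apply: CkS (IH 0) => // x _; exact: is_derive_cst.
Qed.

Lemma Ck_id n U : open U -> Ck n U id.
Proof.
case: n => // n oU; apply: CkS (@Ck_cst n U 1 oU) => // x _; exact: is_derive_id.
Qed.

Lemma CkD n U f g : open U -> Ck n U f -> Ck n U g ->
  Ck n U (fun x => f x + g x).
Proof.
move=> oU; elim: n f g => // n IH f g /CkSP[df Cf] /CkSP[dg Cg].
apply: CkS (IH _ _ Cf Cg) => // x Ux.
by apply: is_deriveD; [exact: df|exact: dg].
Qed.

Lemma CkM n U f g : open U -> Ck n U f -> Ck n U g ->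
  Ck n U (fun x => f x * g x).
Proof.
move=> oU; elim: n f g => // n IH f g Cf Cg.
have [df Cf'] := CkSP Cf; have [dg Cg'] := CkSP Cg.
have := CkD oU (IH _ _ (CkW Cf) Cg') (IH _ _ (CkW Cg) Cf').
apply: CkS => // x Ux.
by apply: is_deriveM; [exact: df|exact: dg].
Qed.

Lemma CkN n U f : open U -> Ck n U f -> Ck n U (fun x => - f x).
Proof.
move=> oU /(CkM oU (@Ck_cst n U (-1) oU)).
by apply: Ck_ext => // x _; rewrite mulN1r.
Qed.

Lemma Ck_comp n U V f g : open U -> (forall x, U x -> V (g x)) ->
  Ck n V f -> Ck n U g -> Ck n U (f \o g).
Proof.
move=> oU UV; elim: n f => // n IH f Cf Cg.
have [df Cf'] := CkSP Cf; have [dg Cg'] := CkSP Cg.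
have := CkM oU (IH _ Cf' (CkW Cg)) Cg'.
apply: CkS => // x Ux.
by apply: is_derive1_comp; [exact/df/UV|exact: dg].
Qed.

Lemma CkV n U f : open U -> (forall x, U x -> f x != 0) ->
  Ck n U f -> Ck n U (fun x => (f x)^-1).
Proof.
move=> oU f0; elim: n => // n IH Cf; have [df Cf'] := CkSP Cf.
have IV := IH (CkW Cf).
have := CkM oU (CkN oU (CkM oU IV IV)) Cf'.
apply: CkS => // x Ux.
apply: (is_derive_eq (is_deriveV (f0 x Ux) (df x Ux))).
by rewrite expr2 invfM.
Qed.

Lemma Ck_expR n : Ck n setT (@expR R).
Proof. by elim: n => // n IH; apply: CkS IH; exact: openT. Qed.

Lemma Ck_cos_sin n : Ck n setT (@cos R) /\ Ck n setT (@sin R).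
Proof.
elim: n => // n [Cc Cs]; split.
- apply: CkS (CkN openT Cs); exact: openT.
- apply: CkS Cc; exact: openT.
Qed.

Lemma Ck_ln n : Ck n [set x : R | 0 < x] (@ln R).
Proof.
have o0 : open [set x : R | 0 < x] by exact: open_gt.
case: n => // n.
have CV : Ck n [set x : R | 0 < x] (fun x => (id x)^-1).
  by apply: (CkV o0 _ (@Ck_id n _ o0)) => x /lt0r_neq0.
by apply: (CkS o0 _ CV) => x x0; exact: is_derive1_ln.
Qed.

Lemma Ck_local n f : (forall x, exists U, [/\ open U, U x & Ck n U f]) ->
  Ck n setT f.
Proof.
elim: n f => // n IH f H; split=> [x _|].
  by have [U [oU Ux [df _]]] := H x; exact: df.
by apply: IH => x; have [U [oU Ux [_ Cf]]] := H x; exists U.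
Qed.

Definition smooth U f := forall n, Ck n U f.

Lemma smoothP f :
  smooth setT f <-> forall n x, derivable (derive1n n f) x 1.
Proof.
split=> [Cf n|df n].
  elim: n f Cf => [|n IH] f Cf x; first by have [+ _] := Cf 1%N; exact.
  by rewrite derive1Sn; apply: IH => m; have [_] := Cf m.+1.
elim: n f df => // n IH f df; split=> [x _|]; first exact: df 0%N x.
by apply: IH => m x; rewrite -derive1Sn; exact: df.
Qed.

Lemma smooth_derive f x : smooth setT f -> is_derive x 1 f (derive1 f x).
Proof. by move=> /(_ 1%N) /CkSP[+ _]; exact. Qed.

Lemma smooth_derive1 f : smooth setT f -> smooth setT (derive1 f).
Proof. by move=> Cf n; have [_] := Cf n.+1. Qed.

Lemma smooth_continuous f : smooth setT f -> continuous f.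
Proof. by move=> Cf x; apply: is_derive_continuous (smooth_derive x Cf). Qed.

Lemma smooth_primitive f P : smooth setT f ->
  (forall x, is_derive x 1 P (f x)) -> smooth setT P.
Proof.
by move=> Cf dP [|n] //; apply: CkS (Cf n); exact: openT.
Qed.

(* The functions x^-k exp (-1/x), extended by 0, are closed under
   differentiation up to linear combinations. *)
Definition flat k x : R := if 0 < x then x^-1 ^+ k * expR (- x^-1) else 0.

Lemma flat_ge0 k x : 0 <= flat k x.
Proof.
rewrite /flat; case: ifP => // x0.
by rewrite mulr_ge0 ?expR_ge0// exprn_ge0// invr_ge0 ltW.
Qed.

(** One term of the exponential series suffices: exp (1/x) is at least x^-(k+1) / (k+1)!, which
    leaves a bound linear in x. *)
Lemma flat_le k x : flat k x <= (k.+1)`!%:R * `|x|.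
Proof.
rewrite /flat; case: ifP => [x0|_]; last by rewrite mulr_ge0.
have xV0 : 0 <= x^-1 by rewrite invr_ge0 ltW.
have := expR_ge1Dxn k xV0; rewrite (gtr0_norm x0) expRN => H.
rewrite ler_pdivrMr ?expR_gt0//.
have {H} : x^-1 ^+ k.+1 / k.+1`!%:R <= expR x^-1 by apply: le_trans H; rewrite lerDr.
rewrite ler_pdivrMr ?ltr0n ?fact_gt0// => H.
rewrite -(ler_pM2r (_ : 0 < x^-1)) ?invr_gt0// -exprSr.
suff -> : k.+1`!%:R * x * expR x^-1 * x^-1 = expR x^-1 * k.+1`!%:R by [].
by field; rewrite gt_eqF.
Qed.

Lemma flat0 k : flat k 0 = 0.
Proof. by rewrite /flat ltxx. Qed.

Lemma flat_continuous0 k : {for 0, continuous (flat k)}.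
Proof.
rewrite /prop_for /continuous_at flat0.
have c0 : (fun x : R => (k.+1)`!%:R * `|x|) @ 0 --> 0.
  have : (fun x : R => (k.+1)`!%:R * `|x|) @ 0 --> (k.+1)`!%:R * `|0 : R|.
    by apply: cvgM; [exact: cvg_cst|exact: norm_continuous].
  by rewrite normr0 mulr0.
apply: (squeeze_cvgr _ (cvg_cst 0) c0).
by apply: nearW => x; rewrite flat_ge0 flat_le.
Qed.

Lemma flat_derive k x :
  is_derive x 1 (flat k) (flat k.+2 x - k%:R * flat k.+1 x).
Proof.
have [x0|x0|->] := ltgtP x 0.
- rewrite /flat !ltNge (ltW x0)/= mulr0 subrr.
  apply: (@near_eq_is_derive _ _ _ (cst 0)).
  near=> y; rewrite ifN// -leNgt; near: y.
  by apply: filterS (open_nbhs_nbhs (conj (@open_lt R 0) x0)) => y /ltW.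
- have xn0 : x != 0 by rewrite gt_eqF.
  have dV := is_deriveV xn0 (@is_derive_id _ _ x 1).
  have dX := @is_deriveX _ _ _ k _ _ _ dV.
  have dN : is_derive x 1 (fun y : R => - y^-1) (x ^- 2).
    apply: (is_derive_eq (@is_deriveN _ _ _ _ _ _ _ dV)).
    by rewrite /GRing.scale/= mulr1 opprK.
  have dE : is_derive x 1 (fun y : R => expR (- y^-1)) (expR (- x^-1) * x ^- 2).
    exact: (@is_derive1_comp R expR (fun y : R => - y^-1) x _ _ (is_derive_expR (- x^-1)) dN).
  have dM := is_deriveM dX dE.
  rewrite {2 3}/flat x0.
  suff H : is_derive x 1 ((fun y : R => y^-1) ^+ k * (fun y => expR (- y^-1)))
     (x^-1 ^+ k.+2 * expR (- x^-1) - k%:R * (x^-1 ^+ k.+1 * expR (- x^-1))).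
    apply: near_eq_is_derive H; near=> y.
    rewrite /flat ifT ?exprfctE//; near: y.
    exact: (open_nbhs_nbhs (conj (@open_gt R 0) x0)).
  apply: (is_derive_eq dM).
  rewrite /GRing.scale/= !exprfctE.
  case: k {dX dM} => [|k]; first by rewrite !expr0 /=; field.
  by rewrite /= !exprS; field.
(* At 0 the slope [flat k z / z] is [flat k.+1 z], which is continuous there with value 0. *)
- rewrite !flat0 mulr0 subrr; apply/is_derive1_caratheodory.
  exists (flat k.+1); split; last exact: flat0.
  + move=> z; rewrite flat0 !subr0 /flat; case: ifP => z0; last by rewrite mul0r.
    by rewrite exprS; field; rewrite gt_eqF.
  + exact: flat_continuous0.
Unshelve. all: by end_near. Qed.

Lemma smooth_flat k : smooth setT (flat k).
Proof.
move=> n; elim: n k => // n IH k.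
have oT : open [set: R] by exact: openT.
have := CkD oT (IH k.+2) (CkN oT (CkM oT (@Ck_cst n setT k%:R oT) (IH k.+1))).
by apply: CkS => // x _; exact: flat_derive.
Qed.

Lemma bump_exists a b : a < b -> exists f, [/\ smooth setT f,
  forall x, ~~ (a < x < b) -> f x = 0 & forall x, a < x < b -> 0 < f x].
Proof.
move=> ab; exists (fun x => flat 0 (x - a) * flat 0 (b - x)); split.
- move=> n; have oT : open [set: R] by exact: openT.
  apply: (CkM oT); apply: (@Ck_comp _ _ setT (flat 0)) => //; try exact: smooth_flat.
    by apply: CkD => //; [exact: Ck_id|exact: Ck_cst].
  by apply: CkD => //; [exact: Ck_cst|apply: CkN => //; exact: Ck_id].
- move=> x; rewrite negb_and -!leNgt => /orP[xa|bx].
    by rewrite {1}/flat subr_gt0 ltNge xa mul0r.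
  by rewrite [X in _ * X]/flat subr_gt0 ltNge bx mulr0.
- move=> x /andP[ax xb]; rewrite /flat !subr_gt0 ax xb !expr0 !mul1r.
  by rewrite mulr_gt0 ?expR_gt0.
Qed.

End Smoothness.

(** * Compactly supported smooth functions *)

Section TestFunctions.
Variable R : realType.
Implicit Types (f : R -> R) (F : R -> R[i]) (a b x : R).

Lemma test_function_mk F a b : smooth setT (re_fun F) -> smooth setT (im_fun F) ->
  (forall x, ~~ (a <= x <= b) -> F x = 0) ->
  test_function F /\ tsupport F `<=` `[a, b].
Proof.
move=> /smoothP sr /smoothP si F0.
have sF : tsupport F `<=` `[a, b].
  have /closure_id -> : closed (`[a, b] : set R) by exact: interval_closed.
  apply: closure_subset => x /= /eqP Fx; rewrite in_itv/=.
  by apply: contra_notT Fx; exact: F0.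
split=> //; split=> [n x|]; first by split.
apply: subclosed_compact sF; [exact: closed_closure|exact: segment_compact].
Qed.

Lemma test_functionP F : test_function F ->
  [/\ smooth setT (re_fun F), smooth setT (im_fun F) &
    exists2 a, 0 < a & forall x, ~~ (- a <= x <= a) -> F x = 0].
Proof.
move=> [sF cF]; split; try by apply/smoothP => n x; have [] := sF n x.
have [M [_ HM]] := compact_bounded cF.
exists (`|M| + 1) => [|x]; first by rewrite ltr_wpDl.
rewrite -ler_norml; apply: contraNeq => Fx.
apply: HM; last exact: subset_closure.
by rewrite (le_lt_trans (ler_norm _))// ltrDl.
Qed.

End TestFunctions.

(** * Componentwise calculus for complex-valued functions; complex powers *)

Section ComplexCalculus.
Variable R : realType.
Local Open Scope complex_scope.
Local Notation Re := complex.Re.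
Local Notation Im := complex.Im.
Implicit Types (F G : R -> R[i]) (f g : R -> R) (x y : R) (z w l : R[i]).

Lemma ReD z w : Re (z + w) = Re z + Re w. Proof. by case: z w => ? ? []. Qed.
Lemma ImD z w : Im (z + w) = Im z + Im w. Proof. by case: z w => ? ? []. Qed.
Lemma ReN z : Re (- z) = - Re z. Proof. by case: z. Qed.
Lemma ImN z : Im (- z) = - Im z. Proof. by case: z. Qed.
Lemma ReM z w : Re (z * w) = Re z * Re w - Im z * Im w.
Proof. by case: z w => ? ? []. Qed.
Lemma ImM z w : Im (z * w) = Re z * Im w + Im z * Re w.
Proof. by case: z w => ? ? []. Qed.
Lemma eqC z w : Re z = Re w -> Im z = Im w -> z = w.
Proof. by case: z w => ? ? [? ?] /= -> ->. Qed.

Lemma realCV x : (x^-1)%:C = (x%:C)^-1.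
Proof. exact: fmorphV. Qed.
Lemma realCM x y : (x * y)%:C = x%:C * y%:C.
Proof. exact: rmorphM. Qed.
Lemma realCD x y : (x + y)%:C = x%:C + y%:C.
Proof. exact: rmorphD. Qed.

Definition is_cderive F x l :=
  is_derive x 1 (re_fun F) (Re l) /\ is_derive x 1 (im_fun F) (Im l).

Lemma is_cderive_eq F x l l' : is_cderive F x l -> l = l' -> is_cderive F x l'.
Proof. by move=> ? <-. Qed.

Lemma near_is_cderive F G x l : (\forall y \near x, F y = G y) ->
  is_cderive F x l -> is_cderive G x l.
Proof.
move=> FG [rF iF]; split.
- apply: near_eq_is_derive rF; apply: filterS FG => y; by rewrite /re_fun => ->.
- apply: near_eq_is_derive iF; apply: filterS FG => y; by rewrite /im_fun => ->.
Qed.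

Lemma is_cderive_cst z x : is_cderive (fun=> z) x 0.
Proof. by split; exact: is_derive_cst. Qed.

Lemma is_cderive_real f x (d : R) : is_derive x 1 f d ->
  is_cderive (fun y => (f y)%:C) x d%:C.
Proof. by move=> df; split=> //=; exact: is_derive_cst. Qed.

Lemma is_cderiveD F G x l l' : is_cderive F x l -> is_cderive G x l' ->
  is_cderive (fun y => F y + G y) x (l + l').
Proof.
move=> [rF iF] [rG iG]; split; rewrite ?ReD ?ImD.
- rewrite (_ : re_fun _ = re_fun F + re_fun G); first exact: is_deriveD.
  by apply/funext => y; rewrite /re_fun ReD.
- rewrite (_ : im_fun _ = im_fun F + im_fun G); first exact: is_deriveD.
  by apply/funext => y; rewrite /im_fun ImD.
Qed.

Lemma is_cderiveM F G x l l' : is_cderive F x l -> is_cderive G x l' ->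
  is_cderive (fun y => F y * G y) x (l * G x + F x * l').
Proof.
move=> [rF iF] [rG iG]; split.
- rewrite (_ : re_fun _ = re_fun F * re_fun G - im_fun F * im_fun G); last first.
    by apply/funext => y; rewrite /re_fun ReM.
  apply: (is_derive_eq (is_deriveB (is_deriveM rF rG) (is_deriveM iF iG))).
  by rewrite /GRing.scale/= ReD !ReM /re_fun /im_fun; ring.
- rewrite (_ : im_fun _ = re_fun F * im_fun G + im_fun F * re_fun G); last first.
    by apply/funext => y; rewrite /im_fun ImM.
  apply: (is_derive_eq (is_deriveD (is_deriveM rF iG) (is_deriveM iF rG))).
  by rewrite /GRing.scale/= ImD !ImM /re_fun /im_fun; ring.
Qed.

Lemma is_cderiveZ z F x l : is_cderive F x l -> is_cderive (fun y => z * F y) x (z * l).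
Proof.
move=> dF; apply: (is_cderive_eq (is_cderiveM (is_cderive_cst z x) dF)).
by rewrite mul0r add0r.
Qed.

Lemma is_cderiveB F G x l l' : is_cderive F x l -> is_cderive G x l' ->
  is_cderive (fun y => F y - G y) x (l - l').
Proof.
move=> dF dG; have := is_cderiveD dF (is_cderiveZ (-1) dG).
rewrite mulN1r; congr is_cderive; apply/funext => y; by rewrite mulN1r.
Qed.

Lemma is_cderive_comp F g x l d : is_cderive F (g x) l -> is_derive x 1 g d ->
  is_cderive (F \o g) x (l * d%:C).
Proof.
move=> [rF iF] dg; split; rewrite ?ReM ?ImM /= mulr0 ?subr0 ?add0r.
- exact: (@is_derive1_comp R (re_fun F) g x _ _ rF dg).
- exact: (@is_derive1_comp R (im_fun F) g x _ _ iF dg).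
Qed.

Lemma cderive0_eq F (a b : R) : a <= b ->
  (forall x, a <= x <= b -> is_cderive F x 0) -> F a = F b.
Proof.
move=> ab dF; apply: eqC.
- by apply: (@derive0_eq _ (re_fun F) a b ab) => x /dF [].
- by apply: (@derive0_eq _ (im_fun F) a b ab) => x /dF [].
Qed.

Definition ccontinuous F x :=
  {for x, continuous (re_fun F)} /\ {for x, continuous (im_fun F)}.

Lemma is_cderive_continuous F x l : is_cderive F x l -> ccontinuous F x.
Proof. by move=> [rF iF]; split; exact: is_derive_continuous. Qed.

Lemma ccontinuousD F G x : ccontinuous F x -> ccontinuous G x ->
  ccontinuous (fun y => F y + G y) x.
Proof.
move=> [rF iF] [rG iG]; split.
- rewrite (_ : re_fun _ = re_fun F + re_fun G); first exact: continuousD.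
  by apply/funext => y; rewrite /re_fun ReD.
- rewrite (_ : im_fun _ = im_fun F + im_fun G); first exact: continuousD.
  by apply/funext => y; rewrite /im_fun ImD.
Qed.

Lemma ccontinuousM F G x : ccontinuous F x -> ccontinuous G x ->
  ccontinuous (fun y => F y * G y) x.
Proof.
move=> [rF iF] [rG iG]; split.
- rewrite (_ : re_fun _ = re_fun F * re_fun G - im_fun F * im_fun G).
    by apply: continuousB; exact: continuousM.
  by apply/funext => y; rewrite /re_fun ReM.
- rewrite (_ : im_fun _ = re_fun F * im_fun G + im_fun F * re_fun G).
    by apply: continuousD; exact: continuousM.
  by apply/funext => y; rewrite /im_fun ImM.
Qed.

Lemma cpowerD x z w : cpower x (z + w) = cpower x z * cpower x w.
Proof.
rewrite /cpower ReD ImD !mulrDl expRD cosD sinD.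
by apply: eqC; rewrite ?(ReM, ImM) /= ?(ReM, ImM) /=; ring.
Qed.

Lemma cpower0 x : cpower x 0 = 1.
Proof.
by rewrite /cpower /= !mul0r expR0 cos0 sin0 mul1r.
Qed.

Lemma cpower1 x : 0 < x -> cpower x 1 = x%:C.
Proof.
move=> x0; rewrite /cpower /= mul1r mul0r cos0 sin0 lnK ?posrE//.
by rewrite -[RHS]mulr1; congr (_ * _).
Qed.

Lemma cpower_neq0 x z : cpower x z != 0.
Proof.
apply/eqP => E; have := cpowerD x z (- z).
by rewrite subrr E mul0r cpower0 => /eqP; rewrite oner_eq0.
Qed.

Lemma cpowerN x z : cpower x (- z) = (cpower x z)^-1.
Proof.
apply: (mulfI (cpower_neq0 x z)).
by rewrite -cpowerD subrr cpower0 mulfV// cpower_neq0.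
Qed.

Lemma is_cderive_cpower x z : 0 < x ->
  is_cderive (fun y => cpower y z) x (z * cpower x (z - 1)).
Proof.
move=> x0; have dl := is_derive1_ln x0.
have dZ (c : R) : is_derive x 1 (fun y => c * ln y) (c * x^-1).
  exact: (@is_deriveZ _ _ _ (@ln R) c x 1 _ dl).
have dE := is_cderive_real (@is_derive1_comp R expR _ x _ _ (is_derive_expR _) (dZ (Re z))).
have dC : is_cderive (fun y => cos (Im z * ln y) +i* sin (Im z * ln y)) x
    ((- sin (Im z * ln x) * (Im z * x^-1)) +i* (cos (Im z * ln x) * (Im z * x^-1))).
  split=> /=.
  - exact: (@is_derive1_comp R cos _ x _ _ (is_derive_cos _) (dZ (Im z))).
  - exact: (@is_derive1_comp R sin _ x _ _ (is_derive_sin _) (dZ (Im z))).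
apply: (is_cderive_eq (is_cderiveM dE dC)) => /=.
rewrite cpowerD cpowerN cpower1// /cpower.
set e := expR _; set c := cos _; set s := sin _.
rewrite -realCV.
by apply: eqC; rewrite ?(ReD, ImD, ReM, ImM) /= ?(ReM, ImM) /=; ring.
Qed.

Lemma Ck_cpower n z : Ck n [set x | 0 < x] (re_fun (fun x => cpower x z)) /\
  Ck n [set x | 0 < x] (im_fun (fun x => cpower x z)).
Proof.
have o0 : open [set x : R | 0 < x] by exact: open_gt.
have Cl c : Ck n [set x : R | 0 < x] (fun x => c * ln x).
  by apply: CkM => //; [exact: Ck_cst|exact: Ck_ln].
have Cc f c : Ck n setT f -> Ck n [set x : R | 0 < x] (fun x => f (c * ln x)).
  by move=> Cf; apply: (Ck_comp o0 (V := setT)) Cf (Cl c).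
have [Ccos Csin] := @Ck_cos_sin R n.
split.
- have := CkM o0 (Cc _ (Re z) (@Ck_expR R n)) (Cc _ (Im z) Ccos).
  by apply: Ck_ext => // x _; rewrite /re_fun /cpower ReM /= mul0r subr0.
- have := CkM o0 (Cc _ (Re z) (@Ck_expR R n)) (Cc _ (Im z) Csin).
  by apply: Ck_ext => // x _; rewrite /im_fun /cpower ImM /= mul0r addr0.
Qed.

(** The sum norm bounds both parts at once and is submultiplicative, without square roots. *)
Definition l1 z := `|Re z| + `|Im z|.

Lemma l1_ge0 z : 0 <= l1 z. Proof. by rewrite addr_ge0. Qed.

Lemma l1M z w : l1 (z * w) <= l1 z * l1 w.
Proof.
rewrite /l1 ReM ImM mulrDl !mulrDr -!normrM.
have := ler_normB (Re z * Re w) (Im z * Im w).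
have := ler_normD (Re z * Im w) (Im z * Re w).
by lra.
Qed.

Lemma l1D z w : l1 (z + w) <= l1 z + l1 w.
Proof.
rewrite /l1 ReD ImD.
have := ler_normD (Re z) (Re w); have := ler_normD (Im z) (Im w); by lra.
Qed.

Lemma l1N z : l1 (- z) = l1 z.
Proof. by rewrite /l1 ReN ImN !normrN. Qed.

Lemma l1_real x : l1 x%:C = `|x|.
Proof. by rewrite /l1 /= normr0 addr0. Qed.

Lemma Re_l1 z : `|Re z| <= l1 z. Proof. by rewrite lerDl. Qed.
Lemma Im_l1 z : `|Im z| <= l1 z. Proof. by rewrite lerDr. Qed.

Lemma l1_cpower x z : l1 (cpower x z) <= 2 * expR (Re z * ln x).
Proof.
apply: le_trans (l1M _ _) _; rewrite l1_real gtr0_norm ?expR_gt0//.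
rewrite mulrC ler_pM2r ?expR_gt0// /l1 /=.
have := cos_max (Im z * ln x); have := sin_max (Im z * ln x); by lra.
Qed.

End ComplexCalculus.

(** * Periodic functions on the half-line and the structure of [A] *)

Section HalfLine.
Variable R : realType.
Local Open Scope complex_scope.
Local Notation Re := complex.Re.
Local Notation Im := complex.Im.
Implicit Types (F G : R -> R[i]) (f g : R -> R) (u v x y M : R) (z w l : R[i]).

(** The substitution u = exp t turns the half-line into the line, where a global primitive
    exists. *)
Lemma primitive_pos g : (forall u, 0 < u -> {for u, continuous g}) ->
  exists P, forall u, 0 < u -> is_derive u 1 P (g u).
Proof.
move=> cg; pose h t := g (expR t) * expR t.
have ch : continuous h.
  move=> t; apply: (@continuousM _ _ (g \o expR) expR t); last exact: continuous_expR.
  apply: continuous_comp; first exact: continuous_expR.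
  by apply: cg; exact: expR_gt0.
have [H dH] := primitive ch.
exists (H \o @ln R) => u u0.
apply: (is_derive_eq (is_derive1_comp (dH (ln u)) (is_derive1_ln u0))).
by rewrite /h lnK ?posrE// mulfK// gt_eqF.
Qed.

Lemma cprimitive_pos F : (forall u, 0 < u -> ccontinuous F u) ->
  exists P, forall u, 0 < u -> is_cderive P u (F u).
Proof.
move=> cF.
have [|P dP] := @primitive_pos (re_fun F); first by move=> u /cF [].
have [|Q dQ] := @primitive_pos (im_fun F); first by move=> u /cF [].
by exists (fun u => P u +i* Q u) => u u0; split; [exact: dP|exact: dQ].
Qed.

Lemma periodic_nat (T : Type) (g : R -> T) M u (n : nat) : 0 < M -> 0 < u ->
  (forall u, 0 < u -> g (u + M) = g u) -> g (u + n%:R * M) = g u.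
Proof.
move=> M0 u0 gM; elim: n => [|n IH]; first by rewrite mul0r addr0.
by rewrite -natr1 mulrDl mul1r addrA gM// ltr_wpDr// mulr_ge0// ltW.
Qed.

Lemma periodic_reduce (T : Type) (g : R -> T) M u v : 0 < M -> 0 < v -> v <= u ->
  (forall u, 0 < u -> g (u + M) = g u) -> exists2 t, v <= t <= v + M & g u = g t.
Proof.
move=> M0 v0 vu gM; pose n := Num.truncn ((u - v) / M).
have uv0 : 0 <= (u - v) / M by rewrite divr_ge0 ?subr_ge0 // ltW.
have := truncn_itv uv0; rewrite -/n ler_pdivlMr// ltr_pdivrMr// -natr1 => /andP[n1 n2].
have vt : v <= u - n%:R * M by lra.
exists (u - n%:R * M); first by apply/andP; split; lra.
by rewrite -(@periodic_nat _ g M (u - n%:R * M) n M0 (lt_le_trans v0 vt) gM) subrK.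
Qed.

Lemma periodic_bounded g M : 0 < M -> (forall u, 0 < u -> g (u + M) = g u) ->
  (forall u, 0 < u -> {for u, continuous g}) ->
  exists D, forall u, 1 <= u -> `|g u| <= D.
Proof.
move=> M0 gM cg.
have M1 : 1 <= 1 + M by rewrite lerDl ltW.
have cw f : (forall u, 0 < u -> {for u, continuous f}) ->
    {within `[1, 1 + M], continuous f}.
  move=> cf; apply: continuous_in_subspaceT => x; rewrite inE/= in_itv/= => /andP[x1 _].
  by apply: cf; exact: lt_le_trans x1.
have [c _ Hc] := EVT_max M1 (cw _ cg).
have [d _ Hd] := EVT_min M1 (cw _ cg).
exists (`|g c| + `|g d|) => u u1.
have [t tI ->] := periodic_reduce M0 ltr01 u1 gM.
have tI' : t \in `[1, 1 + M] by rewrite in_itv.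
have := Hc t tI'; have := Hd t tI'.
have := ler_norm (g c); have := ler_norm (- g d); rewrite normrN.
have := normr_ge0 (g c); have := normr_ge0 (g d).
rewrite ler_norml => *; apply/andP; split; lra.
Qed.

Lemma cperiodic_bounded F M : 0 < M -> (forall u, 0 < u -> F (u + M) = F u) ->
  (forall u, 0 < u -> ccontinuous F u) ->
  exists2 D, 0 <= D & forall u, 1 <= u -> l1 (F u) <= D.
Proof.
move=> M0 FM cF.
have [|u /cF []//|D HD] := @periodic_bounded (re_fun F) M M0.
  by move=> u u0; rewrite /re_fun FM.
have [|u /cF []//|E HE] := @periodic_bounded (im_fun F) M M0.
  by move=> u u0; rewrite /im_fun FM.
exists (D + E) => [|u u1]; last by apply: lerD; [exact: HD|exact: HE].
by apply: addr_ge0; [apply: le_trans (HD 1 _)|apply: le_trans (HE 1 _)].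
Qed.

(* [f] plays the role of the antiderivative at the cusp and [A] that of the
   antiderivative of the translated distribution; [dA = u^(lam+1) df]. *)
Lemma cusp_structure (lam nu : R[i]) M (f J : R -> R[i]) :
  0 < M -> (forall u, 0 < u -> ccontinuous f u) ->
  (forall u, 0 < u -> is_cderive J u (cpower u lam * f u)) ->
  let A := fun u => cpower u (lam + 1) * f u - (lam + 1) * J u in
  (forall u, 0 < u -> A (u + M) - A u = M%:C * (lam * nu)) ->
  exists Psi Psi1 : R -> R[i], exists D : R,
  [/\ forall u, 0 < u -> Psi (u + M) = Psi u,
      forall u, 0 < u -> is_cderive Psi1 u (Psi u),
      forall u, 1 <= u -> l1 (Psi u) <= D,
      forall u, 1 <= u -> l1 (Psi1 u) <= D &
      forall u, 0 < u -> is_cderive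
        (fun u => f u - cpower u (- lam - 1) * Psi u + nu * cpower u (- lam)) u
        ((lam + 1) * (cpower u (- lam - 2) * Psi u))].
Proof.
move=> M0 cf dJ A HA.
pose B u := A u - u%:C * (lam * nu).
have cid u : is_cderive (fun y => y%:C) u (1 : R)%:C.
  by apply: is_cderive_real; exact: is_derive_id.
have cB u : 0 < u -> ccontinuous B u.
  move=> u0; apply: ccontinuousD.
    apply: ccontinuousD.
      by apply: ccontinuousM (cf u u0); exact: is_cderive_continuous (is_cderive_cpower _ u0).
    have := is_cderiveZ (- (lam + 1)) (dJ u u0).
    move/is_cderive_continuous; congr ccontinuous; apply/funext => y.
    by rewrite mulNr.
  have := is_cderiveZ (- (lam * nu)) (cid u).
  by move/is_cderive_continuous; congr ccontinuous; apply/funext => y; rewrite mulNr mulrC.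
have BM u : 0 < u -> B (u + M) = B u.
  by move=> /HA H; rewrite /B realCD mulrDl -H; ring.
have [Q dQ] := cprimitive_pos cB.
(* [C] is the mean of [B] over a period; once it is subtracted, the primitive [Psi1] of [Psi] is
   periodic too, hence bounded. *)
pose C := (M^-1)%:C * (Q (1 + M) - Q 1).
pose Psi u := B u - C.
pose Psi1 u := Q u - C * u%:C.
have MC : M%:C * (M^-1)%:C = 1 by rewrite -realCM mulfV// gt_eqF.
have PM u : 0 < u -> Psi (u + M) = Psi u by move=> u0; rewrite /Psi BM.
have dP1 u : 0 < u -> is_cderive Psi1 u (Psi u).
  move=> u0; apply: (is_cderive_eq (is_cderiveB (dQ u u0) (is_cderiveZ C (cid u)))).
  by rewrite mulr1.
have cP u : 0 < u -> ccontinuous Psi u.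
  move=> u0; apply: ccontinuousD; first exact: cB.
  exact: is_cderive_continuous (is_cderive_cst (- C) u).
have P1M u : 0 < u -> Psi1 (u + M) = Psi1 u.
  move=> u0; pose d y := Psi1 (y + M) - Psi1 y.
  have dd y : 0 < y -> is_cderive d y 0.
    move=> y0; have y1 : 0 < y + M by rewrite addr_gt0.
    have dS : is_derive y 1 (fun y => y + M) (1 : R).
      by apply: (is_derive_eq (is_deriveD (is_derive_id y 1) (is_derive_cst M y 1))); rewrite addr0.
    have := is_cderiveB (@is_cderive_comp _ Psi1 (fun y => y + M) y _ _ (dP1 _ y1) dS) (dP1 y y0).
    by rewrite PM// mulr1 subrr.
  have d1 : d 1 = 0.
    rewrite /d /Psi1 /C realCD (_ : _ - _ = (Q (1 + M) - Q 1) * (1 - M%:C * (M^-1)%:C)); last by ring.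
    by rewrite MC subrr mulr0.
  suff : d u = 0 by move=> /eqP; rewrite subr_eq0 => /eqP.
  rewrite -d1; have [u1|u1] := leP u 1.
    by apply: (cderive0_eq u1) => y /andP[uy _]; apply: dd; exact: lt_le_trans uy.
  apply/esym/(cderive0_eq (ltW u1)) => y /andP[uy _]; apply: dd; exact: lt_le_trans uy.
have [D D0 HD] := cperiodic_bounded M0 PM cP.
have cP1 u : 0 < u -> ccontinuous Psi1 u.
  by move=> u0; exact: is_cderive_continuous (dP1 u u0).
have [D' D'0 HD'] := cperiodic_bounded M0 P1M cP1.
exists Psi, Psi1, (D + D'); split=> //.
- by move=> u u1; rewrite (le_trans (HD u u1))// lerDl.
- by move=> u u1; rewrite (le_trans (HD' u u1))// lerDr.
move=> u u0.
(* [f] and [Psi] are merely continuous, but the combination to be differentiated equals [G], in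
   which they enter only through [J]. *)
pose G u := (lam + 1) * (cpower u (- lam - 1) * J u) + ((lam + 1) * nu) * cpower u (- lam) + C * cpower u (- lam - 1).
apply: (@near_is_cderive _ G).
  near=> y; have y0 : 0 < y by near: y; exact: (open_nbhs_nbhs (conj (@open_gt R 0) u0)).
  rewrite /G /Psi /B /A.
  have -> : cpower y (- lam - 1) = (cpower y lam)^-1 * (y%:C)^-1.
    by rewrite cpowerD !cpowerN cpower1.
  rewrite cpowerN cpowerD cpower1//.
  have l0 := cpower_neq0 y lam.
  have yC : y%:C != 0 by apply/eqP => -[] /eqP; rewrite gt_eqF.
  by field; rewrite yC l0.
have e1 := is_cderive_cpower (- lam - 1) u0.
have e2 := is_cderive_cpower (- lam) u0.
apply: (is_cderive_eq (is_cderiveD (is_cderiveD (is_cderiveZ (lam + 1) (is_cderiveM e1 (dJ u u0))) (is_cderiveZ ((lam + 1) * nu) e2)) (is_cderiveZ C e1))).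
rewrite /Psi /B /A.
have -> : cpower u (- lam - 1 - 1) = (cpower u lam)^-1 * ((u%:C)^-1 * (u%:C)^-1).
  by rewrite !cpowerD !cpowerN cpower1// mulrA.
have -> : cpower u (- lam - 2) = (cpower u lam)^-1 * ((u%:C)^-1 * (u%:C)^-1).
  by rewrite (_ : - lam - 2 = - lam + -1 + -1); [rewrite !cpowerD !cpowerN cpower1// mulrA|ring].
rewrite !cpowerD !cpowerN cpower1//.
have l0 := cpower_neq0 u lam.
have uC : u%:C != 0 by apply/eqP => -[] /eqP; rewrite gt_eqF.
by field; rewrite uC l0.
Unshelve. all: by end_near. Qed.

End HalfLine.

(** * Asymptotic expansion at the cusp *)

Section CuspAsymptotics.
Variable R : realType.
Local Open Scope complex_scope.
Local Notation Re := complex.Re.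
Local Notation Im := complex.Im.
Implicit Types (F G : R -> R[i]) (f g : R -> R) (u v x y s M D K L : R) (z w l lam nu : R[i]).

(** The power u^(-s) for positive [u]. *)
Definition decay s u := expR (- s * ln u).

Lemma decay_gt0 s u : 0 < decay s u. Proof. exact: expR_gt0. Qed.

Lemma decayM s u : 0 < u -> u * decay (s + 1) u = decay s u.
Proof.
move=> u0; rewrite /decay -{1}(lnK (_ : u \in Num.pos)) ?posrE// -expRD.
by congr expR; ring.
Qed.

Lemma is_derive_decay s u : 0 < u -> is_derive u 1 (decay s) (- s * decay (s + 1) u).
Proof.
move=> u0; have dl := @is_deriveZ _ _ _ (@ln R) (- s) u 1 _ (is_derive1_ln u0).
apply: (is_derive_eq (is_derive1_comp (is_derive_expR _) dl)).
rewrite -[expR _]/(decay s u) -(decayM s u0) /GRing.scale/=.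
by field; rewrite gt_eqF.
Qed.

Lemma cvg_decay K s : 0 < s -> K * decay s u @[u --> +oo] --> (0 : R).
Proof.
move=> s0; rewrite -(mulr0 K); apply: cvgM; first exact: cvg_cst.
apply/cvgrPdist_lt => e e0; near=> u.
rewrite sub0r normrN gtr0_norm ?decay_gt0// /decay.
rewrite -[ltRHS](lnK (_ : e \in Num.pos)) ?posrE// ltr_expR mulNr ltrNl.
rewrite -ltr_pdivrMl// -[ltLHS]expRK ltr_ln ?posrE ?expR_gt0//.
Unshelve. all: by end_near. Qed.

Definition ctends F l :=
  (re_fun F u @[u --> +oo] --> Re l) /\ (im_fun F u @[u --> +oo] --> Im l).

Lemma ctendsD F G l l' : ctends F l -> ctends G l' ->
  ctends (fun u => F u + G u) (l + l').
Proof.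
move=> [rF iF] [rG iG]; split; rewrite ?ReD ?ImD.
- rewrite (_ : re_fun _ = re_fun F + re_fun G); first exact: cvgD.
  by apply/funext => u; rewrite /re_fun ReD.
- rewrite (_ : im_fun _ = im_fun F + im_fun G); first exact: cvgD.
  by apply/funext => u; rewrite /im_fun ImD.
Qed.

Lemma cvg_small g K s : 0 < s -> (forall u, 1 <= u -> `|g u| <= K * decay s u) ->
  g u @[u --> +oo] --> (0 : R).
Proof.
move=> s0 gK; have c0 := cvg_decay K s0.
have c1 : - (K * decay s u) @[u --> +oo] --> (0 : R) by rewrite -oppr0; exact: cvgN.
apply: (squeeze_cvgr _ c1 c0); near=> u.
by rewrite -ler_norml; apply: gK; near: u; exact: nbhs_pinfty_ge.
Unshelve. all: by end_near. Qed.

Lemma ctends_small F K s : 0 < s -> (forall u, 1 <= u -> l1 (F u) <= K * decay s u) ->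
  ctends F 0.
Proof.
move=> s0 FK; split; apply: (cvg_small s0) => u u1.
- exact: le_trans (Re_l1 _) (FK u u1).
- exact: le_trans (Im_l1 _) (FK u u1).
Qed.

(** The derivative of [D / s * decay s] is [- (D * decay (s + 1))], so subtracting this function
    from [h] gives a nondecreasing one, which stays below the limit [l]. *)
Lemma le_of_derive_decay (h dh : R -> R) D s (l : R) : 0 < s -> 0 <= D ->
  (forall u, 1 <= u -> is_derive u 1 h (dh u)) ->
  (forall u, 1 <= u -> - (D * decay (s + 1) u) <= dh u) ->
  h u @[u --> +oo] --> l ->
  forall u, 1 <= u -> h u - l <= D / s * decay s u.
Proof.
move=> s0 D0 dh_ Hd hl u u1.
rewrite lerBlDl -lerBlDr.
have key v : u <= v -> h u - D / s * decay s u <= h v.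
  move=> uv.
  have dk y : u <= y <= v ->
      is_derive y 1 (fun y => h y - D / s * decay s y) (dh y + D * decay (s + 1) y).
    move=> /andP[uy _]; have y1 := le_trans u1 uy.
    have y0 : 0 < y by exact: lt_le_trans y1.
    have dZ := @is_deriveZ _ _ _ (decay s) (D / s) y 1 _ (is_derive_decay s y0).
    apply: (is_derive_eq (is_deriveB (dh_ y y1) dZ)).
    by rewrite /GRing.scale/=; field; rewrite gt_eqF.
  have := derive_ge0_le uv dk; move=> /(_ _)/le_trans; apply.
    move=> y /andP[uy _]; rewrite -[_ + _]opprK opprD oppr_ge0 subr_le0 lerNl.
    by apply: Hd; exact: le_trans uy.
  by rewrite gerBl mulr_ge0 ?divr_ge0 ?(ltW s0) ?(ltW (decay_gt0 _ _)).
rewrite -(cvg_lim _ hl); last exact: Rhausdorff.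
apply: limr_ge; first by apply/cvg_ex; exists l.
by near=> v; apply: key.
Unshelve. all: by end_near. Qed.

Lemma norm_of_derive_decay (h dh : R -> R) D s (l : R) : 0 < s -> 0 <= D ->
  (forall u, 1 <= u -> is_derive u 1 h (dh u)) ->
  (forall u, 1 <= u -> `|dh u| <= D * decay (s + 1) u) ->
  h u @[u --> +oo] --> l ->
  forall u, 1 <= u -> `|h u - l| <= D / s * decay s u.
Proof.
move=> s0 D0 dh_ Hd hl u u1; rewrite ler_norml; apply/andP; split.
- have H1 v : 1 <= v -> is_derive v 1 (fun u => - h u) (- dh v).
    by move=> v1; apply: is_deriveN; exact: dh_.
  have H2 v : 1 <= v -> - (D * decay (s + 1) v) <= - dh v.
    by move=> /Hd; rewrite ler_norml lerN2 => /andP[].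
  have H3 : - h u @[u --> +oo] --> - l by exact: cvgN.
  have := le_of_derive_decay s0 D0 H1 H2 H3 u1.
  by rewrite lerNl opprB opprK addrC.
- apply: (le_of_derive_decay s0 D0 dh_ _ hl u1) => v /Hd.
  by rewrite ler_norml => /andP[].
Qed.

Lemma l1_cpowerM u z w D s : 1 <= u -> l1 w <= D -> s <= - Re z ->
  l1 (cpower u z * w) <= 2 * D * decay s u.
Proof.
move=> u1 wD sz; apply: le_trans (l1M _ _) _.
rewrite mulrAC; apply: ler_pM => //; try exact: l1_ge0.
apply: le_trans (l1_cpower _ _) _; rewrite ler_pM2l//.
by rewrite ler_expR ler_wpM2r ?ln_ge0// lerNr.
Qed.

(** The derivative of [E] is of order u^(-lam-2), which by itself gives an error as large as the
    term with [Psi]. Passing to [E2] is an integration by parts that gains one power of [u].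
    Integration down from infinity then gives the estimate; the conditions on [lam] and [nu] make
    every correction term tend to 0 there, so that [E2] has the limit [fo]. *)
Lemma cusp_expansion lam nu D (f Psi Psi1 : R -> R[i]) fo :
  -1 < Re lam -> nu = 0 \/ 0 < Re lam -> ctends f fo ->
  (forall u, 0 < u -> is_cderive Psi1 u (Psi u)) ->
  (forall u, 1 <= u -> l1 (Psi u) <= D) ->
  (forall u, 1 <= u -> l1 (Psi1 u) <= D) ->
  (forall u, 0 < u -> is_cderive
        (fun u => f u - cpower u (- lam - 1) * Psi u + nu * cpower u (- lam)) u
        ((lam + 1) * (cpower u (- lam - 2) * Psi u))) ->
  exists K, forall u, 1 <= u ->
    l1 (u%:C * (f u - fo) - (cpower u (- lam) * Psi u - nu * cpower u (1 - lam)))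
    <= K * decay (Re lam + 1) u.
Proof.
move=> lam1 nu0 ffo dP1 PD P1D dE.
have D0 : 0 <= D by apply: le_trans (PD 1 _); rewrite ?l1_ge0.
pose E u := f u - cpower u (- lam - 1) * Psi u + nu * cpower u (- lam).
pose E2 u := E u - (lam + 1) * (cpower u (- lam - 2) * Psi1 u).
pose c := (lam + 1) * (lam + 2).
have pos u : 1 <= u -> 0 < u by exact: lt_le_trans.
have dE2 u : 1 <= u -> is_cderive E2 u (c * (cpower u (- lam - 3) * Psi1 u)).
  move=> /pos u0.
  apply: (is_cderive_eq (is_cderiveB (dE u u0) (is_cderiveZ (lam + 1)
     (is_cderiveM (is_cderive_cpower (- lam - 2) u0) (dP1 u u0))))).
  rewrite (_ : - lam - 2 - 1 = - lam - 3); last by ring.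
  by rewrite /c; ring.
pose s := Re lam + 2.
have s0 : 0 < s by rewrite /s; lra.
have Re2 : Re (- lam - 2) = - s by rewrite /s !(ReD, ReN) /=; lra.
have Re1 : Re (- lam - 1) = - (Re lam + 1) by rewrite !(ReD, ReN) /=; lra.
have bE2 u : 1 <= u -> l1 (c * (cpower u (- lam - 3) * Psi1 u)) <= (l1 c * (2 * D)) * decay (s + 1) u.
  move=> u1; apply: le_trans (l1M _ _) _; rewrite -mulrA ler_wpM2l ?l1_ge0//.
  by apply: l1_cpowerM => //; [exact: P1D|rewrite /s !(ReD, ReN) /=; lra].
have tE2 : ctends E2 fo.
  rewrite -[fo]addr0 -[fo + 0]addr0 -[fo + 0 + 0]addr0.
  rewrite (_ : E2 = fun u => f u + - cpower u (- lam - 1) * Psi u + nu * cpower u (- lam)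
     + - (lam + 1) * (cpower u (- lam - 2) * Psi1 u)); last first.
    by apply/funext => u; rewrite /E2 /E; ring.
  apply: ctendsD; first apply: ctendsD; first apply: ctendsD => //.
  - apply: (@ctends_small _ (2 * D) (Re lam + 1)); first by lra.
    move=> u u1; rewrite mulNr l1N; apply: l1_cpowerM => //; first exact: PD.
    by rewrite Re1 opprK.
  - case: nu0 => [->|lam0].
      by apply: (@ctends_small _ 0 1) => // u u1; rewrite !mul0r /l1 /= !normr0 addr0.
    apply: (@ctends_small _ (2 * l1 nu) (Re lam)) => // u u1.
    by rewrite mulrC; apply: l1_cpowerM => //; rewrite ReN opprK.
  - apply: (@ctends_small _ (l1 (lam + 1) * (2 * D)) s) => // u u1.
    rewrite mulNr l1N; apply: le_trans (l1M _ _) _.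
    rewrite -[X in _ <= X]mulrA; apply: ler_wpM2l; first exact: l1_ge0.
    by apply: l1_cpowerM => //; [exact: P1D|rewrite Re2 opprK].
set D' := l1 c * (2 * D) in bE2.
have D'0 : 0 <= D' by rewrite /D' !mulr_ge0 ?l1_ge0.
have HE u : 1 <= u -> l1 (E2 u - fo) <= (2 * (D' / s)) * decay s u.
  move=> u1; rewrite /l1 ReD ImD ReN ImN -mulrA mulrDl mul1r.
  apply: lerD.
  - apply: (@norm_of_derive_decay (re_fun E2) (fun v => Re (c * (cpower v (- lam - 3) * Psi1 v))) D' s (Re fo) s0 D'0 _ _ tE2.1 u u1).
    + by move=> v /dE2 [].
    + by move=> v v1; apply: le_trans (Re_l1 _) (bE2 v v1).
  - apply: (@norm_of_derive_decay (im_fun E2) (fun v => Im (c * (cpower v (- lam - 3) * Psi1 v))) D' s (Im fo) s0 D'0 _ _ tE2.2 u u1).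
    + by move=> v /dE2 [].
    + by move=> v v1; apply: le_trans (Im_l1 _) (bE2 v v1).
exists (2 * (D' / s) + l1 (lam + 1) * (2 * D)) => u u1.
have u0 := pos u u1.
have -> : u%:C * (f u - fo) - (cpower u (- lam) * Psi u - nu * cpower u (1 - lam)) =
    u%:C * (E2 u - fo) + (lam + 1) * (cpower u (- lam - 1) * Psi1 u).
  rewrite /E2 /E (_ : - lam - 2 = - lam + -1 + -1); last by ring.
  rewrite !cpowerD !cpowerN cpower1//.
  have l0 := cpower_neq0 u lam.
  have uC : u%:C != 0 by apply/eqP => -[] /eqP; rewrite gt_eqF.
  by field; rewrite uC l0.
apply: le_trans (l1D _ _) _; rewrite [X in _ <= X]mulrDl; apply: lerD.
- apply: le_trans (l1M _ _) _; rewrite l1_real gtr0_norm//.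
  rewrite -(decayM _ u0) mulrCA ler_pM2l//.
  by rewrite (_ : Re lam + 1 + 1 = s); [exact: HE|rewrite /s; ring].
- apply: le_trans (l1M _ _) _; rewrite -[X in _ <= X]mulrA.
  apply: ler_wpM2l; first exact: l1_ge0.
  by apply: l1_cpowerM => //; [exact: P1D|rewrite Re1 opprK].
Qed.

End CuspAsymptotics.

(** * Differentiability read off from the expansion *)

Section CuspCases.
Variable R : realType.
Local Open Scope complex_scope.
Local Notation Re := complex.Re.
Local Notation Im := complex.Im.
Implicit Types (F G : R -> R[i]) (f g : R -> R) (u v x y s M D K : R) (z w lam nu : R[i]).

Lemma cpower_real u z : Im z = 0 -> cpower u z = (decay (- Re z) u)%:C.
Proof.
move=> z0; rewrite /cpower z0 mul0r cos0 sin0 /decay opprK.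
by rewrite -[RHS]mulr1; congr (_ * _).
Qed.

Lemma decayD s s' u : decay s u * decay s' u = decay (s + s') u.
Proof. by rewrite /decay -expRD; congr expR; ring. Qed.

Lemma eq_cvgy f g (l : R) : f =1 g -> f u @[u --> +oo] --> l -> g u @[u --> +oo] --> l.
Proof. by move=> /funext ->. Qed.

Lemma decay0 u : decay 0 u = 1.
Proof. by rewrite /decay oppr0 mul0r expR0. Qed.

(** Along u + n M the value never changes, so it equals the limit. *)
Lemma periodic_cvg_cst g M (l : R) : 0 < M -> (forall u, 0 < u -> g (u + M) = g u) ->
  g u @[u --> +oo] --> l -> forall u, 0 < u -> g u = l.
Proof.
move=> M0 gM gl u u0.
have gn n : g (u + n%:R * M) = g u by exact: periodic_nat.
have cn : (fun n : nat => u + n%:R * M) n @[n --> \oo] --> +oo.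
  apply/cvgryPge => A; near=> n.
  rewrite -lerBlDl -ler_pdivrMr//.
  by near: n; exact: nbhs_infty_ger.
have := cvg_comp _ _ cn gl.
rewrite (_ : g \o _ = fun=> g u); last by apply/funext => n; exact: gn.
move=> H; have := cvg_unique _ H (cvg_cst (g u)).
by move=> /(_ (@Rhausdorff R)) ->.
Unshelve. all: by end_near. Qed.

(** At the phases pi, 2 pi and pi/2, up to the sign of [mu], the left side is -a, a, and b or -b;
    all three equal [L]. *)
Lemma phase_zero (mu a b L : R) : mu != 0 ->
  (forall s, 0 < s -> cos (mu * s) * a + sin (mu * s) * b = L) -> a = 0 /\ b = 0.
Proof.
move=> mu0 H.
have n0 : 0 < `|mu| by rewrite normr_gt0.
have p0 := @pi_gt0 R.
have m s : mu * (s / `|mu|) = Num.sg mu * s.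
  by rewrite {1}[mu]numEsg; field; rewrite normr_eq0.
have H1 := H (pi / `|mu|) (divr_gt0 p0 n0).
have H2 := H ((pi *+ 2) / `|mu|) (divr_gt0 (mulrn_wgt0 2 p0) n0).
have H3 := H ((pi / 2) / `|mu|) (divr_gt0 (divr_gt0 p0 (ltr0n _ 2)) n0).
move: H1 H2 H3; rewrite !m.
have [mp|mn|m0] := ltgtP 0 mu; last by rewrite -m0 eqxx in mu0.
- rewrite (gtr0_sg mp) !mul1r cospi sinpi cos2pi sin2pi cos_pihalf sin_pihalf => *; split; lra.
- rewrite (ltr0_sg mn) !mulN1r !cosN !sinN cospi sinpi cos2pi sin2pi cos_pihalf sin_pihalf => *; split; lra.
Qed.

(* The phase u^(-lam) varies slowly: one period changes it by O(1/u). *)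
Lemma slow_phase (mu a b M t : R) (g : R -> R) (L : R) : 0 < M -> 0 < t ->
  (forall n : nat, let v := t + n%:R * M in
     g v = cos (mu * ln v) * a + sin (mu * ln v) * b) ->
  g u @[u --> +oo] --> L ->
  forall s, 0 < s -> cos (mu * s) * a + sin (mu * s) * b = L.
Proof.
move=> M0 t0 gE gL.
pose h u := cos (mu * ln u) * a + sin (mu * ln u) * b.
pose dh u := (- sin (mu * ln u) * a + cos (mu * ln u) * b) * (mu / u).
have dh_ u : 0 < u -> is_derive u 1 h (dh u).
  move=> u0; have dl := @is_deriveZ _ _ _ (@ln R) mu u 1 _ (is_derive1_ln u0).
  have dc := is_derive1_comp (is_derive_cos _) dl.
  have ds := is_derive1_comp (is_derive_sin _) dl.
  apply: (is_derive_eq (is_deriveD (is_deriveM dc (is_derive_cst a u 1))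
    (is_deriveM ds (is_derive_cst b u 1)))).
  by rewrite /dh /GRing.scale/= /cst; ring.
pose C := (`|a| + `|b|) * `|mu|.
have C0 : 0 <= C by rewrite mulr_ge0.
have bdh u : 0 < u -> `|dh u| <= C / u.
  move=> u0; rewrite /dh normrM normrM normfV (gtr0_norm u0) mulrA.
  rewrite ler_pM2r ?invr_gt0// ler_wpM2r//.
  apply: le_trans (ler_normD _ _) _; rewrite !normrM normrN.
  have := cos_max (mu * ln u); have := sin_max (mu * ln u).
  by move=> ? ?; apply: lerD; apply: ler_piMl.
have hL : h u @[u --> +oo] --> L.
  apply/cvgrPdist_lt => e e0; have e20 : 0 < e / 2 by rewrite divr_gt0.
  have [T [Treal HT]] : \forall u \near +oo, `|L - g u| < e / 2.
    by move/cvgrPdist_lt : gL => /(_ _ e20).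
  near=> u.
  (* Large enough that the sample point [v] with [v <= u < v + M] lies beyond [T], and that the
     derivative bound makes [h] vary by less than e/2 between [v] and [u]. *)
  have u1 : t + M + `|T| + M + 2 * C * M / e < u.
    by near: u; apply: nbhs_pinfty_gt; exact: num_real.
  have CMe : 0 <= 2 * C * M / e by rewrite divr_ge0 ?(ltW e0)// !mulr_ge0// ltW.
  have T0 := normr_ge0 T.
  have tu : t <= u by lra.
  pose n := Num.truncn ((u - t) / M).
  have uv0 : 0 <= (u - t) / M by rewrite divr_ge0 ?subr_ge0// ltW.
  have := truncn_itv uv0; rewrite -/n ler_pdivlMr// ltr_pdivrMr// -natr1 => /andP[n1 n2].
  pose v := t + n%:R * M.
  have vu : v <= u by rewrite /v; lra.
  have uv : u < v + M by rewrite /v; lra.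
  have v0 : 0 < v by lra.
  have vT : T < v by have := ler_norm T; lra.
  have := HT v vT; rewrite gE -/v -/(h v) => hv.
  have huv : `|h u - h v| < e / 2.
    move: vu; rewrite le_eqVlt => /orP[/eqP->|vu]; first by rewrite subrr normr0.
    have [|c /andP[vc cu] ->] := @mean_value _ h dh v u vu.
      by move=> y /andP[vy _]; apply: dh_; exact: lt_le_trans vy.
    have c0 : 0 < c by exact: lt_trans vc.
    rewrite normrM (gtr0_norm (_ : 0 < u - v)) ?subr_gt0//.
    apply: (@le_lt_trans _ _ (C / c * M)).
      by apply: ler_pM; [exact: normr_ge0|lra|exact: bdh|lra].
    rewrite mulrAC ltr_pdivrMr//.
    have : 2 * C * M / e < c by lra.
    by rewrite ltr_pdivrMr//; lra.
  have -> : L - h u = (L - h v) - (h u - h v) by ring.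
  by apply: le_lt_trans (ler_normB _ _) _; lra.
move=> s s0.
have [mu0|mu0] := eqVneq mu 0.
  move: hL; rewrite /h mu0 (_ : (fun u => _) = fun=> cos 0 * a + sin 0 * b); last first.
    by apply/funext => u; rewrite !mul0r.
  move=> H; have := cvg_unique _ H (cvg_cst _).
  by rewrite !mul0r => /(_ (@Rhausdorff R)) <-.
(* In the logarithmic variable [h] becomes periodic, so convergence at infinity forces it to be
   constant. *)
pose k s := cos (mu * s) * a + sin (mu * s) * b.
apply: (@periodic_cvg_cst k (pi *+ 2 / `|mu|)) s0.
- by rewrite divr_gt0 ?normr_gt0// mulrn_wgt0// pi_gt0.
- move=> y _; rewrite /k mulrDr.
  have -> : mu * (pi *+ 2 / `|mu|) = Num.sg mu * (pi *+ 2).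
    by rewrite {1}[mu]numEsg; field; rewrite normr_eq0.
  have [mp|mn|m0] := ltgtP 0 mu; last by rewrite -m0 eqxx in mu0.
  + by rewrite (gtr0_sg mp) mul1r cosD2pi sinD2pi.
  + rewrite (ltr0_sg mn) mulN1r -(cosD2pi (_ - _)) -(sinD2pi (_ - _)).
    by rewrite subrK.
- have ce : (@expR R) x @[x --> +oo] --> +oo.
    apply/cvgryPge => A; near=> y.
    by apply: le_trans (expR_ge1Dx y); rewrite ler_wpDl//; near: y; exact: nbhs_pinfty_ge.
  have := cvg_comp _ _ ce hL.
  by rewrite (_ : h \o _ = k)//; apply/funext => y; rewrite /= /h expRK.
Unshelve. all: by end_near. Qed.

Variables (lam nu : R[i]) (M : R) (f J : R -> R[i]) (fo : R[i]).
Hypotheses (M0 : 0 < M) (lam1 : -1 < Re lam) (nu0 : nu = 0 \/ 0 < Re lam).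
Hypothesis cf : forall u, 0 < u -> ccontinuous f u.
Hypothesis ffo : ctends f fo.
Hypothesis dJ : forall u, 0 < u -> is_cderive J u (cpower u lam * f u).
Let A u := cpower u (lam + 1) * f u - (lam + 1) * J u.
Hypothesis HA : forall u, 0 < u -> A (u + M) - A u = M%:C * (lam * nu).

Let W u := u * Re (f u - fo).

Lemma small_remainder (Psi : R -> R[i]) K :
  (forall u, 1 <= u -> l1 (u%:C * (f u - fo) -
     (cpower u (- lam) * Psi u - nu * cpower u (1 - lam))) <= K * decay (Re lam + 1) u) ->
  (fun u => W u - Re (cpower u (- lam) * Psi u - nu * cpower u (1 - lam))) u @[u --> +oo] --> (0 : R).
Proof.
move=> HK; apply: (@cvg_small _ _ K (Re lam + 1)); first by rewrite -ltrBlDr sub0r.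
move=> u u1; apply: le_trans (HK u u1); apply: le_trans (Re_l1 _).
have E z : Re (u%:C * (f u - fo) - z) = W u - Re z.
  by rewrite ReD ReN ReM /= mul0r subr0.
by rewrite E.
Qed.

Lemma main_term (L : R) (Psi : R -> R[i]) K :
  (forall u, 1 <= u -> l1 (u%:C * (f u - fo) -
     (cpower u (- lam) * Psi u - nu * cpower u (1 - lam))) <= K * decay (Re lam + 1) u) ->
  W u @[u --> +oo] --> L ->
  Re (cpower u (- lam) * Psi u - nu * cpower u (1 - lam)) @[u --> +oo] --> L.
Proof.
move=> HK HW; rewrite -[L]subr0.
rewrite (_ : (fun u => Re _) = fun u => W u - (fun u => W u - Re (cpower u (- lam) * Psi u - nu * cpower u (1 - lam))) u); last first.
  by apply/funext => u /=; ring.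
by apply: cvgB HW _; exact: small_remainder HK.
Qed.

Lemma main_real (Psi : R -> R[i]) u : Im lam = 0 ->
  Re (cpower u (- lam) * Psi u - nu * cpower u (1 - lam)) =
  decay (Re lam) u * Re (Psi u) - Re nu * decay (Re lam - 1) u.
Proof.
move=> l0.
have E1 : cpower u (- lam) = (decay (Re lam) u)%:C.
  by rewrite cpower_real ?ReN ?opprK// ImN l0 oppr0.
have E2 : cpower u (1 - lam) = (decay (Re lam - 1) u)%:C.
  by rewrite cpower_real ?ReD ?ReN ?opprB// ImD ImN l0 oppr0 addr0.
by rewrite E1 E2 ReD ReN !ReM /=; ring.
Qed.

(** For positive lambda the periodic term is damped by u^(-lam); only the term with [nu] could
    prevent convergence. *)
Lemma cusp_differentiable : Im lam = 0 -> 0 < Re lam -> Re nu = 0 ->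
  W u @[u --> +oo] --> (0 : R).
Proof.
move=> l0 lp rn0.
have [Psi [Psi1 [D [PM dP1 PD P1D dE]]]] := cusp_structure M0 cf dJ HA.
have [K HK] := cusp_expansion lam1 nu0 ffo dP1 PD P1D dE.
have H0 : (fun u => decay (Re lam) u * Re (Psi u)) u @[u --> +oo] --> (0 : R).
  apply: (@cvg_small _ _ D (Re lam)) => // u u1.
  rewrite normrM gtr0_norm ?decay_gt0// mulrC ler_pM2r ?decay_gt0//.
  exact: le_trans (Re_l1 _) (PD u u1).
rewrite -[X in _ --> X](addr0 (0 : R)); apply: eq_cvgy (cvgD (small_remainder HK) H0) => u.
by rewrite main_real// rn0 mul0r subr0 subrK.
Qed.

(** Multiplication by u^(lam-1), which tends to 0 because lambda < 1, kills the convergent quantity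
    and the periodic term, and turns the remaining term into the constant [Re nu]. *)
Lemma cusp_not_differentiable (L : R) : Im lam = 0 -> 0 < Re lam -> Re lam < 1 ->
  W u @[u --> +oo] --> L -> Re nu = 0.
Proof.
move=> l0 lp ll HW.
have [Psi [Psi1 [D [PM dP1 PD P1D dE]]]] := cusp_structure M0 cf dJ HA.
have [K HK] := cusp_expansion lam1 nu0 ffo dP1 PD P1D dE.
have HL := main_term HK HW.
have ll0 : 0 < 1 - Re lam by lra.
have d0 := cvg_decay 1 ll0.
have H0 : (fun u => decay 1 u * Re (Psi u)) u @[u --> +oo] --> (0 : R).
  apply: (@cvg_small _ _ D 1) => // u u1.
  rewrite normrM gtr0_norm ?decay_gt0// mulrC ler_pM2r ?decay_gt0//.
  exact: le_trans (Re_l1 _) (PD u u1).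
have E u : decay 1 u * Re (Psi u) - 1 * decay (1 - Re lam) u *
    Re (cpower u (- lam) * Psi u - nu * cpower u (1 - lam)) = Re nu.
  rewrite main_real// mul1r mulrBr mulrA decayD mulrCA decayD.
  rewrite (_ : 1 - Re lam + Re lam = 1); last by ring.
  rewrite (_ : 1 - Re lam + (Re lam - 1) = 0); last by ring.
  by rewrite decay0; ring.
have H : (fun u => decay 1 u * Re (Psi u) - 1 * decay (1 - Re lam) u *
    Re (cpower u (- lam) * Psi u - nu * cpower u (1 - lam))) u @[u --> +oo] --> (0 - 0 * L : R).
  exact: cvgB H0 (cvgM d0 HL).
have := cvg_unique (@Rhausdorff R) (eq_cvgy E H) (cvg_cst (Re nu)).
by rewrite mul0r subr0 => <-.
Qed.

(** Multiplication by u^lam, bounded near infinity, passes convergence on to [Re Psi], which is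
    periodic and hence constant. For real lambda the derivative of the combination in [dE] has a
    real part involving [Re Psi] only. *)
Lemma cusp_real_rigid (L : R) : Im lam = 0 -> Re lam <= 0 ->
  W u @[u --> +oo] --> L ->
  forall u v, 0 < u -> 0 < v -> Re (f u) = Re (f v).
Proof.
move=> l0 ln HW.
have nu00 : nu = 0 by case: nu0 => // H; move: (lt_le_trans H ln); rewrite ltxx.
have [Psi [Psi1 [D [PM dP1 PD P1D dE]]]] := cusp_structure M0 cf dJ HA.
have [K HK] := cusp_expansion lam1 nu0 ffo dP1 PD P1D dE.
have HL := main_term HK HW.
have [c Hc] : exists c : R, re_fun Psi u @[u --> +oo] --> c.
  have HP : decay (Re lam) u * Re (Psi u) @[u --> +oo] --> L.
    apply: eq_cvgy HL => u; by rewrite main_real// nu00 /= mul0r subr0.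
  move: ln; rewrite le_eqVlt => /orP[/eqP l00|ln].
    exists L; apply: eq_cvgy HP => u.
    by rewrite l00 decay0 mul1r.
  have ln' : 0 < - Re lam by rewrite oppr_gt0.
  exists (0 * L); apply: eq_cvgy (cvgM (cvg_decay 1 ln') HP) => u.
  by rewrite mul1r mulrA decayD addNr decay0 mul1r.
have Pc u : 0 < u -> Re (Psi u) = c.
  by apply: (@periodic_cvg_cst (re_fun Psi) M) => // y y0; rewrite /re_fun PM.
(* A nonzero constant [Re Psi] would make its primitive [Re Psi1] grow linearly, against the bound
   [D]. *)
have c0 : c = 0.
  have D0 : 0 <= D by apply: le_trans (PD 1 _); rewrite ?l1_ge0.
  have lin u : 1 < u -> `|c| * (u - 1) <= 2 * D.
    move=> u1; have [|y /andP[y1 _] E] := @mean_value _ (re_fun Psi1) (re_fun Psi) 1 u u1.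
      by move=> y /andP[y1 _]; have [] := dP1 y (lt_le_trans ltr01 y1).
    have Ey := Pc y (lt_trans ltr01 y1); rewrite [re_fun Psi y]Ey in E.
    rewrite -{1}(gtr0_norm (_ : 0 < u - 1)) ?subr_gt0// -normrM -E.
    apply: le_trans (ler_normB _ _) _.
    have := le_trans (Re_l1 _) (P1D u (ltW u1)).
    by have := le_trans (Re_l1 _) (P1D 1 (lexx 1)); rewrite /re_fun; lra.
  apply/eqP; apply: contraT; rewrite -normr_gt0 => cp.
  (* At this point the inequality reads |c| + 2 D <= 2 D. *)
  have := lin (2 + 2 * D / `|c|).
  have : 0 <= 2 * D / `|c| by rewrite divr_ge0// mulr_ge0.
  move=> ? /(_ ltac:(lra)).
  have -> : `|c| * (2 + 2 * D / `|c| - 1) = `|c| + 2 * D.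
    by field; rewrite gt_eqF.
  by lra.
have df u : 0 < u -> is_derive u 1 (re_fun f) 0.
  move=> u0; have [dr _] := dE u u0.
  move: dr; rewrite nu00 ReM.
  have -> : Im (lam + 1) = 0 by rewrite ImD l0 addr0.
  rewrite ReM cpower_real ?ImD ?ImN ?l0 ?oppr0 /= ?addr0 ?subr0// Pc// c0.
  rewrite !mul0r !mulr0 !subr0 ?mulr0.
  apply: near_eq_is_derive; near=> y.
  have y0 : 0 < y by near: y; exact: (open_nbhs_nbhs (conj (@open_gt R 0) u0)).
  rewrite /re_fun ReD ReD ReN mul0r addr0 ReM cpower_real ?ImD ?ImN ?l0 ?oppr0 /= ?addr0 ?subr0//.
  by rewrite Pc// c0 mul0r mulr0 !subr0.
move=> u v; wlog uv : u v / u <= v => [H u0 v0|u0 v0].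
  by have [uv|/ltW uv] := leP u v; [exact: H|apply/esym/H].
apply: (@derive0_eq _ (re_fun f) _ _ uv) => y /andP[uy _]; apply: df; exact: lt_le_trans uy.
Unshelve. all: by end_near. Qed.

(** Along t + n M the value of [Psi] is frozen while u^(-lam) rotates slowly through all phases; a
    limit of the real part of the product then forces both components of [Psi t] to be 0. *)
Lemma cusp_imaginary_rigid (L : R) : Re lam = 0 -> Im lam != 0 ->
  W u @[u --> +oo] --> L ->
  forall u v, 0 < u -> 0 < v -> f u = f v.
Proof.
move=> l0 ln HW.
have nu00 : nu = 0 by case: nu0 => //; rewrite l0 ltxx.
have [Psi [Psi1 [D [PM dP1 PD P1D dE]]]] := cusp_structure M0 cf dJ HA.
have [K HK] := cusp_expansion lam1 nu0 ffo dP1 PD P1D dE.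
have HL := main_term HK HW.
have P0 t : 0 < t -> Psi t = 0.
  move=> t0.
  have [|a0 b0] := @phase_zero (Im lam) (Re (Psi t)) (Im (Psi t)) L ln.
  - apply: (slow_phase M0 t0 _ HL) => n /=.
    rewrite nu00 mul0r subr0 (@periodic_nat _ _ Psi)// ReM /cpower ReN ImN l0 oppr0 mul0r expR0.
    by rewrite mul1r /= mulNr cosN sinN mulNr opprK.
  - by apply: eqC; rewrite ?a0 ?b0.
have df u : 0 < u -> is_cderive f u 0.
  move=> u0; have := dE u u0; rewrite P0// !mulr0.
  apply: near_is_cderive; near=> y.
  have y0 : 0 < y by near: y; exact: (open_nbhs_nbhs (conj (@open_gt R 0) u0)).
  by rewrite P0// nu00 mulr0 mul0r subr0 addr0.
move=> u v; wlog uv : u v / u <= v => [H u0 v0|u0 v0].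
  by have [uv|/ltW uv] := leP u v; [exact: H|apply/esym/H].
apply: (cderive0_eq uv) => y /andP[uy _]; apply: df; exact: lt_le_trans uy.
Unshelve. all: by end_near. Qed.

End CuspCases.

(** * Bumps, shifts and the fundamental lemma of the calculus of variations *)

Section Pairing.
Variable R : realType.
Local Open Scope complex_scope.
Local Notation Re := complex.Re.
Local Notation Im := complex.Im.
Implicit Types (F G A : R -> R[i]) (f g b k : R -> R) (u v x y M D K : R).

Lemma cintegral_FTC F P x y : x < y ->
  (forall t, x <= t <= y -> is_cderive P t (F t)) ->
  (forall t, x <= t <= y -> ccontinuous F t) ->
  (forall t, ~~ (x <= t <= y) -> F t = 0) ->
  cintegral setT F = P y - P x.
Proof.
move=> xy dP cF F0; apply: eqC; rewrite /cintegral ?ReD ?ImD ?ReN ?ImN /=.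
- apply: (@Rintegral_FTC R (re_fun F) (re_fun P) x y) => // t; first by move/dP => [].
    by move/cF => [].
  by move/F0; rewrite /re_fun => ->.
- apply: (@Rintegral_FTC R (im_fun F) (im_fun P) x y) => // t; first by move/dP => [].
    by move/cF => [].
  by move/F0; rewrite /im_fun => ->.
Qed.

Lemma cprimitive F : (forall u, ccontinuous F u) ->
  exists P, forall u, is_cderive P u (F u).
Proof.
move=> cF.
have [|P dP] := @primitive R (re_fun F); first by move=> u; have [] := cF u.
have [|Q dQ] := @primitive R (im_fun F); first by move=> u; have [] := cF u.
by exists (fun u => P u +i* Q u) => u; split; [exact: dP|exact: dQ].
Qed.

Lemma ccontinuous_real f x : {for x, continuous f} -> ccontinuous (fun y => (f y)%:C) x.
Proof. by move=> cf; split=> //; exact: cst_continuous. Qed.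

Lemma near_ccontinuous F G x : (\forall y \near x, F y = G y) ->
  ccontinuous F x -> ccontinuous G x.
Proof.
move=> FG [rF iF].
have E := nbhs_singleton FG.
split; rewrite /prop_for /continuous_at /re_fun /im_fun -E.
- by apply: cvg_trans rF; apply: near_eq_cvg; apply: filterS FG => y; rewrite /re_fun => ->.
- by apply: cvg_trans iF; apply: near_eq_cvg; apply: filterS FG => y; rewrite /im_fun => ->.
Qed.

(** [A] is controlled only on the half-line; a factor vanishing up to [a] makes the product
    continuous on the whole line, so that global primitives are available. *)
Lemma ccontinuous_cut A b a : 0 < a -> (forall u, u <= a -> b u = 0) ->
  continuous b -> (forall u, 0 < u -> ccontinuous A u) ->
  forall u, ccontinuous (fun u => A u * (b u)%:C) u.
Proof.
move=> a0 b0 cb cA u; have [au|ua] := leP a u.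
  apply: ccontinuousM; first by apply: cA; exact: lt_le_trans au.
  by apply: ccontinuous_real; exact: cb.
apply: (@near_ccontinuous (fun=> 0)).
  near=> y; rewrite b0 ?mulr0//; apply/ltW; near: y.
  exact: (open_nbhs_nbhs (conj (@open_lt R a) ua)).
exact: is_cderive_continuous (is_cderive_cst 0 u).
Unshelve. all: by end_near. Qed.

Lemma derive_shift f (d M x : R) : is_derive (x - M) 1 f d ->
  is_derive x 1 (fun y => f (y - M)) d.
Proof.
move=> df; have ds : is_derive x 1 (fun y => y - M) 1.
  apply: (is_derive_eq (is_deriveB (is_derive_id x 1) (is_derive_cst M x 1))).
  by rewrite subr0.
by have := @is_derive1_comp R f (fun y => y - M) x _ _ df ds; rewrite mulr1.
Qed.

Lemma cderive_shift F d M x : is_cderive F (x - M) d ->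
  is_cderive (fun y => F (y - M)) x d.
Proof.
by move=> [rF iF]; split; [exact: (@derive_shift (re_fun F))|exact: (@derive_shift (im_fun F))].
Qed.

(** [k u] is the integral of [b] over [[u - M, u]], a primitive of [b] minus its shift: compactly
    supported, although the primitive is not. *)
Definition shifted_bump (a1 b1 M : R) b k := [/\ smooth setT b,
  forall u, ~~ (a1 < u < b1) -> b u = 0, forall u, a1 < u < b1 -> 0 < b u,
  smooth setT k & (forall u, is_derive u 1 k (b u - b (u - M))) /\
  forall u, ~~ (a1 < u < b1 + M) -> k u = 0].

Lemma shifted_bump_exists (a1 b1 M : R) : a1 < b1 -> 0 < M ->
  exists b k, shifted_bump a1 b1 M b k.
Proof.
move=> ab M0; have [b [sb b0 bp]] := bump_exists ab.
have [P dP] := primitive (smooth_continuous sb).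
have sP := smooth_primitive sb dP.
have oT : open [set: R] by exact: openT.
have shift_smooth h : smooth setT h -> smooth setT (fun u => h (u - M)).
  move=> sh n; apply: (@Ck_comp _ _ setT setT h) => //.
  by apply: CkD => //; [exact: Ck_id|exact: Ck_cst].
exists b, (fun u => P u - P (u - M)); split=> //.
  by move=> n; apply: CkD => //; apply: CkN => //; exact: shift_smooth.
split=> [u|u].
  by apply: is_deriveB => //; exact: derive_shift.
rewrite negb_and -!leNgt => H.
have uM : u - M <= u by rewrite gerBl ltW.
apply/eqP; rewrite subr_eq0; apply/eqP/esym/(derive0_eq uM) => y /andP[y1 y2].
rewrite -(b0 y)//.
case/orP: H => H; rewrite negb_and -!leNgt.
  by rewrite (le_trans y2 H).
by rewrite orbC (le_trans _ y1)// lerBrDr.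
Qed.

Section Shift.
Variables (a1 b1 M : R) (b k : R -> R).
Hypotheses (a0 : 0 < a1) (ab : a1 < b1) (M0 : 0 < M).
Hypothesis bk : shifted_bump a1 b1 M b k.

Let b2 := b1 + M.
Let ab2 : a1 < b2. Proof. by rewrite /b2 ltr_wpDr// ltW. Qed.
Let k_a1 : k a1 = 0.
Proof. by case: bk => _ _ _ _ [_ ->]//; rewrite ltxx. Qed.
Let k_b2 : k b2 = 0.
Proof. by case: bk => _ _ _ _ [_ ->]//; rewrite ltxx andbF. Qed.

(** Translating the part with [b (u - M)] by [M] moves the shift onto [A]. [X] and [V] are
    primitives of the integrands before and after, so their total increments agree up to sign. *)
Lemma shift_primitives A : (forall u, 0 < u -> ccontinuous A u) ->
  exists X V, [/\ forall u, is_cderive X u (A u * (b u - b (u - M))%:C),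
    forall u, is_cderive V u ((A (u + M) - A u) * (b u)%:C) &
    X b2 - X a1 = - (V b1 - V a1)].
Proof.
move=> cA; have [sb b0 _ _ _] := bk.
have cb := smooth_continuous sb.
have b0' u : u <= a1 -> b u = 0 by move=> ua; apply: b0; rewrite negb_and -leNgt ua.
have [V dV] := cprimitive (ccontinuous_cut a0 b0' cb cA).
have cAM u : 0 < u -> ccontinuous (fun u => A (u + M)) u.
  move=> u0; have [rA iA] := cA (u + M) (addr_gt0 u0 M0).
  have cs : {for u, continuous (fun y => y + M)}.
    by apply: continuousD; [exact: cvg_id|exact: cvg_cst].
  by split; [apply: (continuous_comp cs rA)|apply: (continuous_comp cs iA)].
have [V2 dV2] := cprimitive (ccontinuous_cut a0 b0' cb cAM).
exists (fun u => V u - V2 (u - M)), (fun u => V2 u - V u); split.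
- move=> u; have := is_cderiveB (dV u) (cderive_shift (dV2 (u - M))).
  by rewrite subrK; congr is_cderive; rewrite (realCD (b u) (- b (u - M))) rmorphN; ring.
- move=> u; apply: (is_cderive_eq (is_cderiveB (dV2 u) (dV u))); ring.
- have E1 : V b1 = V b2.
    apply: cderive0_eq => [|y /andP[y1 _]]; first by rewrite lerDl ltW.
    by apply: (is_cderive_eq (dV y)); rewrite b0 ?mulr0// negb_and -!leNgt y1 orbT.
  have E2 : V2 (a1 - M) = V2 a1.
    apply: cderive0_eq => [|y /andP[_ y1]]; first by rewrite gerBl ltW.
    by apply: (is_cderive_eq (dV2 y)); rewrite b0'// mulr0.
  by rewrite -E1 E2 /b2 addrK; ring.
Qed.

(* Integration by parts moves the derivative onto the test function, where it
   becomes a difference that is then shifted back to [E]. *)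
Lemma cintegral_shift E E' : (forall u, is_cderive E u (E' u)) ->
  (forall u, ccontinuous E' u) ->
  exists V, (forall u, is_cderive V u ((E (u + M) - E u) * (b u)%:C)) /\
  forall P, (forall u, is_cderive P u (E' u * (k u)%:C)) -> P b2 - P a1 = V b1 - V a1.
Proof.
move=> dE cE'; have cE u : 0 < u -> ccontinuous E u.
  by move=> _; exact: is_cderive_continuous (dE u).
have [X [V [dX dV E1]]] := shift_primitives cE.
exists V; split=> // P dP.
have [_ _ _ _ [dk _]] := bk.
have : P a1 - (E a1 * (k a1)%:C - X a1) = P b2 - (E b2 * (k b2)%:C - X b2).
  apply: (@cderive0_eq _ (fun u => P u - (E u * (k u)%:C - X u))); first exact: ltW.
  move=> u _; apply: (is_cderive_eq (is_cderiveB (dP u) (is_cderiveB (is_cderiveM (dE u) (is_cderive_real (dk u))) (dX u)))).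
  by ring.
rewrite k_a1 k_b2 !mulr0 !sub0r !opprK => H.
have -> : P b2 - P a1 = - (X b2 - X a1).
  by apply/eqP; rewrite -subr_eq0; apply/eqP; transitivity (P b2 + X b2 - (P a1 + X a1)); [ring|rewrite -H subrr].
by rewrite E1 opprK.
Qed.

End Shift.

(** On a small interval around [u] where [D] has no zero, equal values of [V] at the ends produce,
    by the mean value theorem, a zero of [D * b] inside, where [b] is positive. *)
Lemma fundamental_lemma (D : R -> R) : (forall u, 0 < u -> {for u, continuous D}) ->
  (forall a1 b1 : R, 0 < a1 -> a1 < b1 -> exists b V,
     [/\ forall u, a1 < u < b1 -> 0 < b u,
       forall u, is_derive u 1 V (D u * b u) & V a1 = V b1]) ->
  forall u, 0 < u -> D u = 0.
Proof.
move=> cD H u u0; apply/eqP; apply: contraT => Du.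
have : \forall y \near u, D y != 0.
  have /cvgrPdist_lt /(_ `|D u|) := cD u u0.
  rewrite normr_gt0 => /(_ Du); apply: filterS => y; apply: contraTN => /eqP ->.
  by rewrite subr0 ltxx.
move=> /nbhs_ballP[e /= e0 He].
pose d := Num.min (e / 2) (u / 2).
have d0 : 0 < d by rewrite lt_min !divr_gt0.
have de : d <= e / 2 by rewrite ge_min lexx.
have du : d <= u / 2 by rewrite ge_min lexx orbT.
have [||b [V [bp dV VV]]] := H (u - d) (u + d); try lra.
have dd : u - d < u + d by lra.
have [c /andP[c1 c2]] := mean_value dd (fun x _ => dV x).
rewrite VV subrr => /esym/eqP; rewrite !mulf_eq0 => /orP[/orP[|]|].
- by apply: contraTT => _; apply: He; rewrite /ball/= ltr_norml; apply/andP; split; lra.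
- by rewrite gt_eqF// bp// c1.
- by move=> /eqP; lra.
Qed.

End Pairing.

(** * Pairing a distribution with the test function attached to a cusp *)

Section DistributionPairing.
Variable R : realType.
Local Open Scope complex_scope.
Local Notation Re := complex.Re.
Local Notation Im := complex.Im.
Implicit Types (F G A : R -> R[i]) (U V : set R) (f k : R -> R) (u v x y M : R).

Definition cCk n U F := Ck n U (re_fun F) /\ Ck n U (im_fun F).

Lemma cCkM n U F G : open U -> cCk n U F -> cCk n U G -> cCk n U (fun x => F x * G x).
Proof.
move=> oU [rF iF] [rG iG]; split.
- have := CkD oU (CkM oU rF rG) (CkN oU (CkM oU iF iG)).
  by apply: Ck_ext => // x _; rewrite /re_fun ReM.
- have := CkD oU (CkM oU rF iG) (CkM oU iF rG).
  by apply: Ck_ext => // x _; rewrite /im_fun ImM.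
Qed.

Lemma cCk_comp n U V F f : open U -> (forall x, U x -> V (f x)) ->
  cCk n V F -> Ck n U f -> cCk n U (F \o f).
Proof. by move=> oU UV [rF iF] Cf; split; [apply: (Ck_comp oU UV rF)|apply: (Ck_comp oU UV iF)]. Qed.

Lemma cCk_ext n U F G : open U -> (forall x, U x -> F x = G x) -> cCk n U F -> cCk n U G.
Proof.
by move=> oU FG [rF iF]; split; [apply: Ck_ext rF|apply: Ck_ext iF] => // x Ux; rewrite /re_fun /im_fun FG.
Qed.

Lemma cCk_cst n U (z : R[i]) : open U -> cCk n U (fun=> z).
Proof. by move=> oU; split; exact: Ck_cst. Qed.

Lemma cCk_real n U f : open U -> Ck n U f -> cCk n U (fun x => (f x)%:C).
Proof. by move=> oU Cf; split=> //; exact: Ck_cst. Qed.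

Lemma is_cderive_unique F x l l' : is_cderive F x l -> is_cderive F x l' -> l = l'.
Proof.
by move=> [[_ r] [_ i]] [[_ r'] [_ i']]; apply: eqC; [rewrite -r -r'|rewrite -i -i'].
Qed.

Lemma test_cderive F : test_function F -> forall x, is_cderive F x (cderiven 1 F x).
Proof.
move=> /test_functionP[sr si _] x.
by split; rewrite /cderiven derive1n1; exact: smooth_derive.
Qed.

Lemma test_ccontinuous1 F : test_function F -> forall x, ccontinuous (cderiven 1 F) x.
Proof.
move=> /test_functionP[sr si _] x; split.
- rewrite (_ : re_fun _ = derive1 (re_fun F)); first exact/smooth_continuous/smooth_derive1.
  by apply/funext => y; rewrite /re_fun /cderiven derive1n1.
- rewrite (_ : im_fun _ = derive1 (im_fun F)); first exact/smooth_continuous/smooth_derive1.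
  by apply/funext => y; rewrite /im_fun /cderiven derive1n1.
Qed.

Section Antiderivative.
Variables (T : functional R) (c0 : R[i]) (phi : R -> R[i]).
Hypothesis HT : eq_on setT T (dist_add (dist_of (fun=> c0)) (dist_deriv (dist_of phi))).
Hypothesis cphi : forall x, ccontinuous phi x.

Let rho x := c0 * x%:C + phi x.

Lemma is_cderive_id x : is_cderive (fun y => y%:C) x (1 : R[i]).
Proof. by apply: is_cderive_real; exact: is_derive_id. Qed.

Lemma ccontinuous_rho x : ccontinuous rho x.
Proof.
apply: ccontinuousD => //.
exact: is_cderive_continuous (is_cderiveZ c0 (is_cderive_id x)).
Qed.

(** [rho] is a primitive of the distribution, so [T g] is minus the integral of [rho] times g'.
    Stating this through an arbitrary primitive [P] lets later changes of variable act on [P]. *)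
Lemma pairing_primitive g P x y : test_function g -> x < y ->
  (forall t, ~~ (x < t < y) -> g t = 0) ->
  (forall t, is_cderive P t (rho t * cderiven 1 g t)) -> T g = P x - P y.
Proof.
move=> tg xy g0 dP.
have dg := test_cderive tg; have cg := test_ccontinuous1 tg.
have cid t : ccontinuous (fun y => c0 * y%:C) t.
  exact: is_cderive_continuous (is_cderiveZ c0 (is_cderive_id t)).
have [P1 dP1] := cprimitive (fun t => ccontinuousM (cid t) (cg t)).
have [P2 dP2] := cprimitive (fun t => ccontinuousM (cphi t) (cg t)).
have g'0 t : ~~ (x <= t <= y) -> cderiven 1 g t = 0.
  move=> tn; apply: is_cderive_unique (dg t) _.
  apply: near_is_cderive (is_cderive_cst 0 t).
  move: tn; rewrite negb_and -!ltNge => /orP[tx|yt]; near=> s; apply/esym/g0;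
    rewrite negb_and -!leNgt; apply/orP; [left|right]; apply/ltW; near: s.
  - exact: (open_nbhs_nbhs (conj (@open_lt R x) tx)).
  - exact: (open_nbhs_nbhs (conj (@open_gt R y) yt)).
have g0' t : ~~ (x <= t <= y) -> g t = 0.
  by move=> tn; apply: g0; apply: contra tn => /andP[/ltW -> /ltW ->].
rewrite HT// /dist_add /dist_deriv /dist_of.
pose Q t := c0 * (t%:C * g t) - P1 t.
have dQ t : is_cderive Q t (c0 * g t).
  apply: (is_cderive_eq (is_cderiveB (is_cderiveZ c0 (is_cderiveM (is_cderive_id t) (dg t))) (dP1 t))).
  by ring.
rewrite (@cintegral_FTC _ (fun x => c0 * g x) Q x y xy); last 3 first.
- by move=> t _; exact: dQ.
- by move=> t _; apply: is_cderive_continuous (is_cderiveZ c0 (dg t)).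
- by move=> t /g0' ->; rewrite mulr0.
rewrite (@cintegral_FTC _ (fun x => phi x * cderiven 1 g x) P2 x y xy); last 3 first.
- by move=> t _; exact: dP2.
- by move=> t _; exact: ccontinuousM.
- by move=> t /g'0 ->; rewrite mulr0.
have : P x - (P1 x + P2 x) = P y - (P1 y + P2 y).
  apply: (@cderive0_eq _ (fun t => P t - (P1 t + P2 t))); first exact: ltW.
  move=> t _; apply: (is_cderive_eq (is_cderiveB (dP t) (is_cderiveD (dP1 t) (dP2 t)))).
  by rewrite /rho; ring.
move=> H; have -> : P x - P y = (P1 x + P2 x) - (P1 y + P2 y).
  have -> : P x = P y - (P1 y + P2 y) + (P1 x + P2 x) by rewrite -H; ring.
  by ring.
have gx : g x = 0 by apply: g0; rewrite ltxx.
have gy : g y = 0 by apply: g0; rewrite ltxx andbF.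
by rewrite /Q gx gy; ring.
Unshelve. all: by end_near. Qed.

Section Cusp.
Variables (alpha beta : R) (kap lam : R[i]) (a1 b1 M : R) (b k : R -> R).
Variables (J X : R -> R[i]).
Hypotheses (beta0 : beta != 0) (a0 : 0 < a1) (ab : a1 < b1) (M0 : 0 < M).
Hypothesis bk : shifted_bump a1 b1 M b k.

Let b2 := b1 + M.
Let Y u := (alpha - u^-1) / beta.
Let f u := rho (Y u).
Let A u := cpower u (lam + 1) * f u - (lam + 1) * J u.
Hypothesis dJ : forall u, 0 < u -> is_cderive J u (cpower u lam * f u).
Hypothesis dX : forall u, 0 < u -> is_cderive X u (A u * (b u - b (u - M))%:C).

(* The test function that the slash action attaches to [k]; the variable of [k]
   is [u = 1 / (alpha - beta y)], which tends to infinity at the cusp. *)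
Definition cusp_test y := if 0 < alpha - beta * y then
  kap * (cpower (alpha - beta * y)^-1 (lam + 1) * (k (alpha - beta * y)^-1)%:C) else 0.
Let g := cusp_test.

Let b20 : 0 < b2. Proof. by rewrite /b2; move: a0 ab M0; lra. Qed.
Let ab2 : a1 < b2. Proof. by rewrite /b2; move: ab M0; lra. Qed.

Lemma cusp_testY u : 0 < u -> g (Y u) = kap * (cpower u (lam + 1) * (k u)%:C).
Proof.
move=> u0; rewrite /g /cusp_test /Y.
have -> : alpha - beta * ((alpha - u^-1) / beta) = u^-1 by field; rewrite beta0 gt_eqF.
by rewrite invr_gt0 u0 invrK.
Qed.

Lemma cusp_test_supp y : g y != 0 -> b2^-1 < alpha - beta * y < a1^-1.
Proof.
rewrite /g /cusp_test; case: ifP => [t0 kn|_]; last by rewrite eqxx.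
have : a1 < (alpha - beta * y)^-1 < b2.
  apply: contraNT kn => H; have [_ _ _ _ [_ k0]] := bk.
  by rewrite k0// !mulr0.
move=> /andP[H1 H2]; have ti := lt_trans a0 H1.
rewrite -[X in _ < X < _]invrK; apply/andP; split.
  by rewrite ltf_pV2// posrE.
by rewrite ltf_pV2// posrE.
Qed.

Let lo := Num.min (Y a1) (Y b2).
Let hi := Num.max (Y a1) (Y b2).

Lemma cusp_test_zero y : ~~ (lo < y < hi) -> g y = 0.
Proof.
move=> H; apply/eqP; apply: contraNT H => /cusp_test_supp /andP[H1 H2].
rewrite /lo /hi gt_min lt_max /Y.
have [bp|bn|/eqP] := ltgtP 0 beta; last by rewrite eq_sym (negbTE beta0).
- rewrite !ltr_pdivrMr// !ltr_pdivlMr//; apply/andP; split; apply/orP; [left|right]; lra.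
- rewrite !ltr_ndivrMr// !ltr_ndivlMr//; apply/andP; split; apply/orP; [right|left]; lra.
Qed.

Lemma cusp_lohi : lo < hi.
Proof.
have iab : b2^-1 < a1^-1 by rewrite ltf_pV2// posrE.
rewrite /lo /hi gt_min !lt_max !ltxx /= orbF /Y.
have [bp|bn|/eqP] := ltgtP 0 beta; last by rewrite eq_sym (negbTE beta0).
- by rewrite ltr_pM2r ?invr_gt0//; apply/orP; left; lra.
- by rewrite !ltr_nM2r ?invr_lt0//; apply/orP; right; lra.
Qed.

Lemma cusp_test_test : test_function g.
Proof.
suff sg n : cCk n setT g.
  have [|//] := @test_function_mk R g lo hi (fun n => (sg n).1) (fun n => (sg n).2).
  move=> x H; apply: cusp_test_zero; apply: contra H => /andP[/ltW -> /ltW ->] //.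
have loc y : exists U, [/\ open U, U y & cCk n U g].
  have ct : continuous (fun y => alpha - beta * y).
    by move=> z; apply: continuousB; [exact: cvg_cst|apply: mulrl_continuous].
  have [t0|t0] := ltP 0 (alpha - beta * y); last first.
    (* The zero branch extends to this open set: since [k] vanishes beyond [b2], the formula is
       already 0 before the cut-off. *)
    pose U := [set y | alpha - beta * y < b2^-1].
    have oU : open U by exact: (open_comp (fun z _ => ct z) (@open_lt R b2^-1)).
    exists U; split=> //; first by rewrite /U/=; apply: le_lt_trans t0 _; rewrite invr_gt0.
    apply: cCk_ext (@cCk_cst n U 0 oU) => // z Uz; apply/esym/eqP.
    by apply: contraTT Uz => /cusp_test_supp /andP[H _]; rewrite /U/= -leNgt ltW.
  pose U := [set y | 0 < alpha - beta * y].
  have oU : open U by exact: (open_comp (fun z _ => ct z) (@open_gt R 0)).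
  exists U; split=> //.
  have Ct : Ck n U (fun y => (alpha - beta * y)^-1).
    apply: CkV => //; first by move=> z /lt0r_neq0.
    apply: CkD => //; first exact: Ck_cst.
    by apply: CkN => //; apply: CkM => //; [exact: Ck_cst|exact: Ck_id].
  have tU z : U z -> [set x | 0 < x] (alpha - beta * z)^-1 by rewrite /U/= invr_gt0.
  have Cp := cCk_comp oU tU (@Ck_cpower R n (lam + 1)) Ct.
  have Ckk : Ck n U (fun y => k (alpha - beta * y)^-1).
    by apply: (@Ck_comp _ _ _ setT k _ oU _ _ Ct) => //; have [_ _ _] := bk; exact.
  have := cCkM oU (@cCk_cst n U kap oU) (cCkM oU Cp (cCk_real oU Ckk)).
  by apply: cCk_ext => // z Uz; rewrite /g /cusp_test ifT.
split; apply: Ck_local => y; have [U [oU Uy [rC iC]]] := loc y; by exists U.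
Qed.

(** This is where [A] comes from. In the variable [u] the derivative of the test function splits
    into u^(lam+1) k' and (lam+1) u^lam k; integrating the latter against [f] by parts, through [J],
    leaves [A] times k'. The sign of [beta] tells whether [Y] reverses orientation. *)
Lemma cusp_pairing : T g = - ((Num.sg beta)%:C * kap * (X b2 - X a1)).
Proof.
have tg := cusp_test_test.
have [P dP] := cprimitive (fun t => ccontinuousM (ccontinuous_rho t) (test_ccontinuous1 tg t)).
have -> : T g = (Num.sg beta)%:C * (P (Y a1) - P (Y b2)).
  rewrite (@pairing_primitive g P lo hi tg cusp_lohi cusp_test_zero dP) /lo /hi.
  have iab : b2^-1 < a1^-1 by rewrite ltf_pV2// posrE.
  have [bp|bn|/eqP] := ltgtP 0 beta; last by rewrite eq_sym (negbTE beta0).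
  - have YY : Y a1 < Y b2 by rewrite /Y ltr_pM2r ?invr_gt0//; lra.
    by rewrite (min_l (ltW YY)) (max_r (ltW YY)) gtr0_sg// mul1r.
  - have YY : Y b2 < Y a1 by rewrite /Y ltr_nM2r ?invr_lt0//; lra.
    by rewrite (min_r (ltW YY)) (max_l (ltW YY)) ltr0_sg//; rewrite rmorphN rmorph1; ring.
have [_ _ _ _ [dk k0]] := bk.
have dY u : 0 < u -> is_derive u 1 Y (u ^- 2 / beta).
  move=> u0; have un0 : u != 0 by rewrite gt_eqF.
  have dV := is_deriveV un0 (@is_derive_id _ _ u 1).
  have dB := is_deriveB (is_derive_cst alpha u 1) dV.
  rewrite (_ : Y = beta^-1 \*: (cst alpha - (fun y : R => y^-1))); last first.
    by apply/funext => z; rewrite /Y /= /GRing.scale/= mulrC.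
  apply: (is_derive_eq (@is_deriveZ _ _ _ _ beta^-1 _ _ _ dB)).
  by rewrite /GRing.scale/=; field; rewrite beta0 un0.
have dgY u : 0 < u -> cderiven 1 g (Y u) * (u ^- 2 / beta)%:C =
    kap * (((lam + 1) * cpower u lam) * (k u)%:C + cpower u (lam + 1) * (b u - b (u - M))%:C).
  move=> u0; apply: is_cderive_unique (is_cderive_comp (test_cderive tg (Y u)) (dY u u0)) _.
  apply: (@near_is_cderive _ (fun u => kap * (cpower u (lam + 1) * (k u)%:C))).
    near=> v; rewrite /= cusp_testY//; near: v.
    exact: (open_nbhs_nbhs (conj (@open_gt R 0) u0)).
  apply: (is_cderive_eq (is_cderiveZ kap (is_cderiveM (is_cderive_cpower (lam + 1) u0) (is_cderive_real (dk u))))).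
  by rewrite addrK.
have : P (Y a1) - kap * ((lam + 1) * (J a1 * (k a1)%:C) + X a1) =
       P (Y b2) - kap * ((lam + 1) * (J b2 * (k b2)%:C) + X b2).
  apply: (@cderive0_eq _ (fun u => P (Y u) - kap * ((lam + 1) * (J u * (k u)%:C) + X u))); first exact: ltW.
  move=> u /andP[u1 _]; have u0 := lt_le_trans a0 u1.
  apply: (is_cderive_eq (is_cderiveB (is_cderive_comp (dP (Y u)) (dY u u0))
    (is_cderiveZ kap (is_cderiveD (is_cderiveZ (lam + 1) (is_cderiveM (dJ u0) (is_cderive_real (dk u)))) (dX u0))))).
  by rewrite -mulrA dgY// /A /f; ring.
have ka : k a1 = 0 by apply: k0; rewrite ltxx.
have kb : k b2 = 0 by apply: k0; rewrite ltxx andbF.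
rewrite ka kb !mulr0 !add0r => H.
have -> : P (Y a1) = P (Y b2) - kap * X b2 + kap * X a1 by rewrite -H; ring.
by ring.
Unshelve. all: by end_near. Qed.

End Cusp.
End Antiderivative.
End DistributionPairing.

(** * Pairing a Fourier series with shifted bumps *)

Section FourierPairing.
Variable R : realType.
Local Open Scope complex_scope.
Local Notation Re := complex.Re.
Local Notation Im := complex.Im.
Implicit Types (f : R -> R) (u v x y : R).

Lemma e2pi_int x (m : int) : e2pi (x + m%:~R) = e2pi x.
Proof.
have e1 y : e2pi (y + 1) = e2pi y.
  rewrite /e2pi mulrDr mulr1 (_ : 2 * pi = pi *+ 2); last by rewrite mulr_natl.
  by rewrite cosD2pi sinD2pi.
have en y (n : nat) : e2pi (y + n%:R) = e2pi y.
  by elim: n => [|n IH]; rewrite ?addr0// -natr1 addrA e1.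
case: m => n; first by rewrite -pmulrn en.
by rewrite NegzE -(en (x + (- n.+1%:Z)%:~R) n.+1) mulrNz -pmulrn subrK.
Qed.

Section Bump.
Variables (a1 b1 M beta gam : R) (b k : R -> R).
Hypotheses (a0 : 0 < a1) (ab : a1 < b1) (M0 : 0 < M) (beta0 : beta != 0).
Hypothesis bk : shifted_bump a1 b1 M b k.
Let b2 := b1 + M.
Let ab2 : a1 < b2. Proof. by rewrite /b2; move: ab M0; lra. Qed.

Let lo := Num.min ((a1 - gam) / beta) ((b2 - gam) / beta).
Let hi := Num.max ((a1 - gam) / beta) ((b2 - gam) / beta).

Lemma affine_lohi : lo < hi.
Proof.
have iab : a1 - gam < b2 - gam by move: ab2; lra.
rewrite /lo /hi gt_min !lt_max !ltxx /= orbF.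
have [bp|bn|/eqP] := ltgtP 0 beta; last by rewrite eq_sym (negbTE beta0).
- by rewrite ltr_pM2r ?invr_gt0// iab.
- by rewrite !ltr_nM2r ?invr_lt0// iab orbT.
Qed.

Lemma affine_in x : (lo <= x <= hi) = (a1 <= beta * x + gam <= b2).
Proof.
have iab : a1 - gam < b2 - gam by move: ab2; lra.
rewrite /lo /hi.
have [bp|bn|/eqP] := ltgtP 0 beta; last by rewrite eq_sym (negbTE beta0).
- have H : (a1 - gam) / beta <= (b2 - gam) / beta by rewrite ler_pM2r ?invr_gt0// ltW.
  rewrite (min_l H) (max_r H) ler_pdivrMr// ler_pdivlMr// [x * _]mulrC.
  by rewrite lerBlDr lerBrDr.
- have H : (b2 - gam) / beta <= (a1 - gam) / beta by rewrite ler_nM2r ?invr_lt0// ltW.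
  rewrite (min_r H) (max_l H) ler_ndivrMr// ler_ndivlMr// [x * _]mulrC.
  by rewrite lerBlDr lerBrDr andbC.
Qed.

Lemma affine_zero x : ~~ (lo <= x <= hi) -> k (beta * x + gam) = 0.
Proof.
rewrite affine_in => H; have [_ _ _ _ [_ k0]] := bk; apply: k0.
by apply: contra H => /andP[/ltW -> /ltW ->].
Qed.

Lemma is_derive_affine x : is_derive x 1 (fun y => beta * y + gam) beta.
Proof.
have dZ := @is_deriveZ _ _ _ id beta x 1 _ (is_derive_id x 1).
apply: (is_derive_eq (is_deriveD dZ (is_derive_cst gam x 1))).
by rewrite /GRing.scale/= mulr1 addr0.
Qed.

Lemma affine_test : test_function (fun x => (k (beta * x + gam))%:C) /\
  tsupport (fun x => (k (beta * x + gam))%:C) `<=` [set x | a1 <= beta * x + gam].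
Proof.
have oT : open [set: R] by exact: openT.
have Ck1 n : Ck n setT (fun x => k (beta * x + gam)).
  apply: (@Ck_comp _ _ setT setT k) => //; first by have [_ _ _ sk _] := bk; exact: sk.
  apply: CkD => //; last exact: Ck_cst.
  by apply: CkM => //; [exact: Ck_cst|exact: Ck_id].
have [||x|H1 H2] := @test_function_mk R (fun x => (k (beta * x + gam))%:C) lo hi.
- exact: Ck1.
- by move=> n; exact: Ck_cst.
- by move=> /affine_zero ->.
split=> // x /H2; rewrite /= in_itv/= affine_in => /andP[] //.
Qed.

Lemma affine_cintegral E K : (forall u, ccontinuous E u) ->
  (forall u, is_cderive K u (E u * (k u)%:C)) ->
  cintegral setT (fun x => E (beta * x + gam) * (k (beta * x + gam))%:C) =
  (`|beta|^-1)%:C * (K b2 - K a1).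
Proof.
move=> cE dK.
pose P x := (beta^-1)%:C * K (beta * x + gam).
have dP x : is_cderive P x (E (beta * x + gam) * (k (beta * x + gam))%:C).
  have := is_cderiveZ (beta^-1)%:C (@is_cderive_comp _ K (fun y => beta * y + gam) x _ _ (dK (beta * x + gam)) (is_derive_affine x)).
  by rewrite mulrCA -realCM mulVf// mulr1.
have cs x : {for x, continuous (fun y => beta * y + gam)}.
  exact: is_derive_continuous (is_derive_affine x).
have ck : continuous k by have [_ _ _ sk _] := bk; exact: smooth_continuous.
rewrite (@cintegral_FTC _ _ P lo hi affine_lohi); last 3 first.
- by move=> t _; exact: dP.
- move=> t _; apply: ccontinuousM; last first.
    by apply: ccontinuous_real; apply: (continuous_comp (cs t)); exact: ck.
  by have [rE iE] := cE (beta * t + gam); split;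
    [apply: (continuous_comp (cs t) rE)|apply: (continuous_comp (cs t) iE)].
- by move=> t /affine_zero ->; rewrite mulr0.
have inv z : beta * ((z - gam) / beta) + gam = z by field.
rewrite /P /lo /hi.
have iab : a1 - gam < b2 - gam by move: ab2; lra.
have [bp|bn|/eqP] := ltgtP 0 beta; last by rewrite eq_sym (negbTE beta0).
- have H : (a1 - gam) / beta <= (b2 - gam) / beta by rewrite ler_pM2r ?invr_gt0// ltW.
  by rewrite (min_l H) (max_r H) !inv gtr0_norm//; ring.
- have H : (b2 - gam) / beta <= (a1 - gam) / beta by rewrite ler_nM2r ?invr_lt0// ltW.
  rewrite (min_r H) (max_l H) !inv ltr0_norm// invrN rmorphN; ring.
Qed.

(** As a function of [u] the mode is the derivative of an M-periodic function, because [M] is |beta|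
    N; its increments over [M] vanish. *)
Lemma fourier_mode_zero (N : nat) (n : int) : (0 < N)%N -> M = `|beta| * N%:R -> n != 0 ->
  dist_of (fun x => e2pi (n%:~R * x / N%:R)) (fun x => (k (beta * x + gam))%:C) = 0.
Proof.
move=> N0 ME n0; have NR : N%:R != 0 :> R by rewrite pnatr_eq0 -lt0n.
have nR : n%:~R != 0 :> R by rewrite intr_eq0.
pose th u := n%:~R * ((u - gam) / beta) / N%:R.
pose E u : R[i] := e2pi (th u).
pose w : R := 2 * pi * (n%:~R / beta / N%:R).
have w0 : w != 0 by rewrite !mulf_neq0 ?invr_eq0// gt_eqF// pi_gt0.
pose z : R[i] := 0 +i* w.
have z0 : z != 0 by apply/eqP => -[] /eqP; rewrite (negbTE w0).
have dth u : is_derive u 1 (fun u => 2 * pi * th u) w.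
  have dZ := @is_deriveZ _ _ _ id w u 1 _ (is_derive_id u 1).
  have dD := is_deriveD dZ (is_derive_cst (2 * pi * th 0) u 1).
  rewrite (_ : (fun u => 2 * pi * th u) = (w \*: id) + cst (2 * pi * th 0)); last first.
    apply/funext => v; rewrite /th /w /= fctE /= /GRing.scale/=; field.
    by rewrite NR beta0.
  by apply: (is_derive_eq dD); rewrite /GRing.scale/= mulr1 addr0.
have dE u : is_cderive E u (z * E u).
  split; rewrite ?ReM ?ImM /=.
  - apply: (is_derive_eq (is_derive1_comp (is_derive_cos _) (dth u))).
    by rewrite mul0r sub0r mulrC mulrN.
  - apply: (is_derive_eq (is_derive1_comp (is_derive_sin _) (dth u))).
    by rewrite mul0r add0r mulrC.
have dE' u : is_cderive (fun u => z^-1 * E u) u (E u).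
  by apply: (is_cderive_eq (is_cderiveZ z^-1 (dE u))); rewrite mulKf.
have cE u : ccontinuous E u by exact: is_cderive_continuous (dE u).
have EM u : E (u + M) = E u.
  rewrite /E.
  have [bp|bn|/eqP] := ltgtP 0 beta; last by rewrite eq_sym (negbTE beta0).
  - have -> : th (u + M) = th u + n%:~R.
      by rewrite /th ME (gtr0_norm bp); field; rewrite NR gt_eqF.
    by rewrite e2pi_int.
  - have -> : th (u + M) = th u + (- n)%:~R.
      by rewrite /th ME (ltr0_norm bn) mulrNz; field; rewrite NR lt_eqF.
    by rewrite e2pi_int.
have [V [dV HV]] := cintegral_shift a0 ab M0 bk dE' cE.
have ck : continuous k by have [_ _ _ sk _] := bk; exact: smooth_continuous.
have [K dK] := cprimitive (fun u => ccontinuousM (cE u) (ccontinuous_real (ck u))).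
have := affine_cintegral cE dK.
rewrite HV// -(@cderive0_eq _ V a1 b1) ?(ltW ab)//; last first.
  by move=> u _; apply: (is_cderive_eq (dV u)); rewrite EM subrr mul0r.
rewrite subrr mulr0 => <-; rewrite /dist_of; congr cintegral; apply/funext => x.
congr (e2pi _ * _); rewrite /th; field; by rewrite NR beta0.
Qed.

(** All symmetric partial sums are 0, so their limit is 0 without any estimate. The constant mode is
    the derivative of a linear function, whose increment over [M], divided by |beta|, gives the
    factor [N]. *)
Lemma fourier_pairing (T : functional R) (N : nat) (c : int -> R[i]) (B : R -> R) :
  (0 < N)%N -> M = `|beta| * N%:R -> fourier_series N T c ->
  (forall u, is_derive u 1 B (b u)) ->
  T (fun x => (k (beta * x + gam))%:C) = c 0 * (N%:R * (B b1 - B a1))%:C.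
Proof.
move=> N0 ME HF dB; have [tf _] := affine_test.
have := HF _ tf; rewrite /sum_nonzero_is /ccvg => -[HR HI].
set l := T _ - _ in HR HI.
have S0 K : \sum_(1 <= j < K.+1) (c j%:Z * dist_of (fun x => e2pi ((j%:Z)%:~R * x / N%:R)) (fun x => (k (beta * x + gam))%:C) +
    c (- j%:Z) * dist_of (fun x => e2pi ((- j%:Z)%:~R * x / N%:R)) (fun x => (k (beta * x + gam))%:C)) = 0.
  rewrite big_nat; apply: big1 => j /andP[j1 _].
  by rewrite !fourier_mode_zero ?mulr0 ?addr0// ?oppr_eq0 -?lt0n// -(inj_eq (@intr_inj R))/= pnatr_eq0 -lt0n.
have HR0 : (fun=> 0 : R) @ \oo --> Re l.
  by apply: cvg_trans HR; apply: near_eq_cvg; apply: nearW => K; rewrite /= S0.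
have HI0 : (fun=> 0 : R) @ \oo --> Im l.
  by apply: cvg_trans HI; apply: near_eq_cvg; apply: nearW => K; rewrite /= S0.
have l0 : l = 0.
  by apply: eqC; [apply: (cvg_unique (@Rhausdorff R) HR0)|apply: (cvg_unique (@Rhausdorff R) HI0)]; exact: cvg_cst.
move: l0 => /eqP; rewrite subr_eq0 => /eqP ->.
have dE u : is_cderive (fun u => c 0 * u%:C) u (c 0).
  by apply: (is_cderive_eq (is_cderiveZ (c 0) (is_cderive_id u))); rewrite mulr1.
have cE u : ccontinuous (fun=> c 0) u by exact: is_cderive_continuous (is_cderive_cst (c 0) u).
have [V [dV HV]] := cintegral_shift a0 ab M0 bk dE cE.
have ck : continuous k by have [_ _ _ sk _] := bk; exact: smooth_continuous.
have [K dK] := cprimitive (fun u => ccontinuousM (cE u) (ccontinuous_real (ck u))).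
have := affine_cintegral cE dK; rewrite HV// /dist_of => ->.
have VE : V b1 - V a1 = c 0 * M%:C * (B b1 - B a1)%:C.
  have : V a1 - c 0 * M%:C * (B a1)%:C = V b1 - c 0 * M%:C * (B b1)%:C.
    apply: (@cderive0_eq _ (fun u => V u - c 0 * M%:C * (B u)%:C)); first exact: ltW.
    move=> u _; apply: (is_cderive_eq (is_cderiveB (dV u) (is_cderiveZ (c 0 * M%:C) (is_cderive_real (dB u))))).
    by rewrite realCD; ring.
  rewrite realCD rmorphN => H.
  have -> : V b1 = V a1 - c 0 * M%:C * (B a1)%:C + c 0 * M%:C * (B b1)%:C by rewrite H; ring.
  by ring.
have bC : (`|beta|)%:C != 0 :> R[i] by apply/eqP => -[] /eqP; rewrite normr_eq0 (negbTE beta0).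
by rewrite VE ME !realCM realCV; field.
Qed.

End Bump.
End FourierPairing.

(** * Quasi-periodicity of [A] from the group action *)

Section TranslateRelation.
Variable R : realType.
Local Open Scope complex_scope.
Local Notation Re := complex.Re.
Local Notation Im := complex.Im.

Lemma mx2E (A : pzSemiRingType) (a b c d : A) :
  [/\ mx2 a b c d 0 0 = a, mx2 a b c d 0 1 = b, mx2 a b c d 1 0 = c & mx2 a b c d 1 1 = d].
Proof. by split; rewrite mxE. Qed.

Lemma mx2_eq (A : pzSemiRingType) (g h : 'M[A]_2) :
  g 0 0 = h 0 0 -> g 0 1 = h 0 1 -> g 1 0 = h 1 0 -> g 1 1 = h 1 1 -> g = h.
Proof.
move=> e00 e01 e10 e11; apply/matrixP => i j.
have o (x : 'I_2) : x = 0 \/ x = 1.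
  by case: x => [[|[|]]] // lx; [left|right]; apply/val_inj.
by case: (o i) => ->; case: (o j) => ->.
Qed.

Lemma mx2M (A : pzSemiRingType) (a b c d a' b' c' d' : A) :
  mx2 a b c d *m mx2 a' b' c' d' =
  mx2 (a * a' + b * c') (a * b' + b * d') (c * a' + d * c') (c * b' + d * d').
Proof.
by apply: mx2_eq; rewrite !mxE !big_ord_recr big_ord0 /= !mxE /= add0r.
Qed.

Lemma mx2_1 (A : pzSemiRingType) : mx2 1 0 0 1 = 1%:M :> 'M[A]_2.
Proof. by apply: mx2_eq; rewrite !mxE. Qed.

Lemma invmx_toR (p q r s : int) : p * r - q * s = 1 ->
  invmx (toR R (mx2 r (- s) (- q) p)) = mx2 p%:~R s%:~R q%:~R r%:~R.
Proof.
move=> H.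
have HR : p%:~R * r%:~R - q%:~R * s%:~R = 1 :> R by rewrite -!intrM -rmorphB H.
have E : toR R (mx2 r (- s) (- q) p) = mx2 r%:~R (- s%:~R) (- q%:~R) p%:~R.
  by apply: mx2_eq; rewrite !mxE//= ?rmorphN.
have I : mx2 p%:~R s%:~R q%:~R r%:~R *m toR R (mx2 r (- s) (- q) p) = 1%:M.
  rewrite E mx2M -mx2_1; congr mx2; move: HR; lra.
have [_ U] := mulmx1_unit I.
by rewrite -[LHS]mul1mx -I -mulmxA mulmxV// mulmx1.
Qed.

Lemma SL2Z_mx2 (p q r s : int) : p * r - q * s = 1 -> SL2Z (mx2 r (- s) (- q) p).
Proof.
move=> H; rewrite /SL2Z /= (expand_det_row _ 0) !big_ord_recr big_ord0 /= /cofactor !det_mx11 !mxE /=.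
rewrite /bump /= !expr0 expr1 !mul1r -[RHS]H; ring.
Qed.

Section Relation.
Variables (lam : R[i]) (delta : 'Z_2) (tau gtau : dist_pair R).
Variables (N : nat) (c0 : R[i]) (cg : int -> R[i]) (phi : R -> R[i]).
Variables (p q r s : int) (sg : R).
Hypothesis HT : eq_on setT tau.1 (dist_add (dist_of (fun=> c0)) (dist_deriv (dist_of phi))).
Hypothesis cphi : forall x, ccontinuous phi x.
Hypotheses (N0 : (0 < N)%N) (q0 : 0 < q) (det1 : p * r - q * s = 1).
Hypothesis Htr : translate lam delta (mx2 r (- s) (- q) p) tau gtau.
Hypothesis Hfou : fourier_series N gtau.1 cg.
Hypothesis sg1 : sg = 1 \/ sg = -1.

Let pR : R := p%:~R.
Let qR : R := q%:~R.
Let rR : R := r%:~R.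
Let sR : R := s%:~R.
Let alpha := sg * pR.
Let beta := sg * qR.
Let qR0 : 0 < qR. Proof. by rewrite ltr0z. Qed.
Let sgsg : sg * sg = 1. Proof. by case: sg1 => ->; rewrite ?mulr1 ?mulrNN ?mulr1. Qed.
Let sg0 : sg != 0. Proof. by case: sg1 => ->; rewrite ?oppr_eq0 oner_eq0. Qed.
Let beta0 : beta != 0. Proof. by rewrite mulf_neq0// gt_eqF. Qed.
Let sgbeta : Num.sg beta = sg.
Proof. by rewrite sgrM (gtr0_sg qR0) mulr1; case: sg1 => ->; rewrite ?sgrN sgr1. Qed.
Let nbeta : `|beta| = qR.
Proof. by rewrite normrM (gtr0_norm qR0); case: sg1 => ->; rewrite ?normrN normr1 mul1r. Qed.
Let detR : pR * rR - qR * sR = 1. Proof. by rewrite -!intrM -rmorphB det1. Qed.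

(** The affine variable [u = sg * (q x + r)] and the Moebius variable [y] are linked by
    [alpha - beta * y = u^-1]. The Jacobian u^2 and the weight u^(lam-1) combine to the exponent lam
    + 1 of [cusp_test]. *)
Lemma translate_test (a1 b1 M : R) (b k : R -> R) : 0 < a1 -> a1 < b1 -> 0 < M ->
  shifted_bump a1 b1 M b k ->
  gtau.1 (fun x => (k (beta * x + sg * rR))%:C) =
  tau.1 (cusp_test alpha beta (sg ^+ delta)%:C lam k).
Proof.
move=> a0 ab M0 bk; have [tf sf] := affine_test (sg * rR) ab M0 beta0 bk.
have [[_ H _] _] := Htr; move: H; rewrite invmx_toR//.
have [e00 e01 e10 e11] := mx2E (p%:~R : R) s%:~R q%:~R r%:~R.
move=> /(_ _ tf) ->; last first.
  (* On the support [u >= a1 > 0], so the pole [q x + r = 0] is avoided. *)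
  apply: (subset_trans sf) => x /= Hx; rewrite e10 e11 -/qR -/rR.
  apply/eqP => E; move: Hx; rewrite (_ : beta * x + sg * rR = sg * (qR * x + rR)); last by rewrite /beta; ring.
  by rewrite E mulr0; lra.
rewrite /slash /dist_mul /dist_moebius e00 e01 e10 e11 -/pR -/qR -/rR -/sR.
congr (tau.1 _); apply/funext => y.
rewrite /cusp_test.
have -> : alpha - beta * y = sg * (pR - qR * y) by rewrite /alpha /beta; ring.
set t := pR - qR * y.
(* At [t = 0] both sides are 0: on the left because the inverse of 0 is 0, on the right by the
   strict inequality in [cusp_test]. *)
have [t0|tn0] := eqVneq t 0.
  by rewrite t0 mulr0 ltxx expr0n /= invr0 mul0r.
have X1 : qR * ((rR * y - sR) / t) + rR = t^-1.
  rewrite -(mulfK tn0 (qR * _ + rR)) mulrDl -mulrA divfK//.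
  rewrite (_ : qR * (rR * y - sR) + rR * t = 1) ?mul1r//.
  by rewrite -detR /t; ring.
have X2 : beta * ((rR * y - sR) / t) + sg * rR = (sg * t)^-1.
  have -> : beta * ((rR * y - sR) / t) + sg * rR = sg * (qR * ((rR * y - sR) / t) + rR).
    by rewrite /beta; ring.
  rewrite X1 invfM; congr (_ * _).
  by apply: (mulfI sg0); rewrite sgsg mulfV.
(* Where the condition of [cusp_test] fails, [u] is not positive and [k] vanishes. *)
rewrite X1 X2; case: ifPn => [st|]; last first.
  rewrite -leNgt => st; have [_ _ _ _ [_ k0]] := bk; rewrite k0 ?mulr0//.
  rewrite negb_and -leNgt; apply/orP; left; apply: le_trans (ltW a0).
  by rewrite invr_le0.
have sgt : Num.sg (t^-1) = sg.
  have -> : t^-1 = sg * (sg * t)^-1 by rewrite invfM mulrA mulfV// mul1r.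
  rewrite sgrM (gtr0_sg (_ : 0 < (sg * t)^-1)) ?invr_gt0// mulr1.
  by case: sg1 => ->; rewrite ?sgrN sgr1.
have nt : `|t^-1| = (sg * t)^-1.
  have -> : t^-1 = sg * (sg * t)^-1 by rewrite invfM mulrA mulfV// mul1r.
  rewrite normrM (gtr0_norm (_ : 0 < (sg * t)^-1)) ?invr_gt0//.
  have -> : `|sg| = 1 by case: sg1 => ->; rewrite ?normrN normr1.
  by rewrite mul1r.
rewrite /weight sgt nt.
set u := (sg * t)^-1.
have u0 : 0 < u by rewrite invr_gt0.
have -> : t ^- 2 = u * u.
  by rewrite /u -invfM mulrACA sgsg mul1r expr2.
rewrite realCM !cpowerD cpowerN cpower1//.
have uC : u%:C != 0 by apply/eqP => -[] /eqP; rewrite gt_eqF.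
by field.
Qed.

(** Two evaluations of the translate on one test function are compared: its Fourier series gives
    [cg 0] times [N] times the integral of the bump, the group action gives increments of [A]
    against the bump. As the interval carrying the bump is arbitrary, the identity holds
    pointwise. *)
Lemma translate_relation (J : R -> R[i]) :
  let f := fun u => c0 * ((alpha - u^-1) / beta)%:C + phi ((alpha - u^-1) / beta) in
  (forall u : R, 0 < u -> is_cderive J u (cpower u lam * f u)) ->
  let A := fun u => cpower u (lam + 1) * f u - (lam + 1) * J u in
  let M := qR * N%:R in
  forall u : R, 0 < u -> A (u + M) - A u = M%:C * ((sg * sg ^+ delta)%:C * cg 0 / qR%:C).
Proof.
move=> f dJ A M.
have M0 : 0 < M by rewrite mulr_gt0// ltr0n.
have MN : M = `|beta| * N%:R by rewrite nbeta.
have sgd : sg ^+ delta * sg ^+ delta = 1 by rewrite -exprMn sgsg expr1n.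
have dY (u : R) : 0 < u -> is_derive u 1 (fun u => (alpha - u^-1) / beta) (u ^- 2 / beta).
  move=> u0; have un0 : u != 0 by rewrite gt_eqF.
  have dV := is_deriveV un0 (@is_derive_id _ _ u 1).
  have dB := is_deriveB (is_derive_cst alpha u 1) dV.
  rewrite (_ : (fun u => _) = beta^-1 \*: (cst alpha - (fun y : R => y^-1))); last first.
    by apply/funext => z; rewrite /= /GRing.scale/= mulrC.
  apply: (is_derive_eq (@is_deriveZ _ _ _ _ beta^-1 _ _ _ dB)).
  by rewrite /GRing.scale/=; field; rewrite beta0 un0.
have cf (u : R) : 0 < u -> ccontinuous f u.
  move=> u0; have cY := is_derive_continuous (dY u u0).
  have [rc ic] := ccontinuous_rho c0 cphi ((alpha - u^-1) / beta).
  by split; [apply: (continuous_comp cY rc)|apply: (continuous_comp cY ic)].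
have cA (u : R) : 0 < u -> ccontinuous A u.
  move=> u0; apply: ccontinuousD.
    by apply: ccontinuousM (cf u u0); exact: is_cderive_continuous (is_cderive_cpower _ u0).
  have := is_cderiveZ (- (lam + 1)) (dJ u u0).
  by move/is_cderive_continuous; congr ccontinuous; apply/funext => y; rewrite mulNr.
set kk := _ * _ / _.
pose D u := A (u + M) - A u - M%:C * kk.
have cD (u : R) : 0 < u -> ccontinuous D u.
  move=> u0; apply: ccontinuousD; last first.
    exact: is_cderive_continuous (is_cderive_cst (- (M%:C * kk)) u).
  apply: ccontinuousD.
    have [rA iA] := cA (u + M) (addr_gt0 u0 M0).
    have cs : {for u, continuous (fun y => y + M)}.
      by apply: continuousD; [exact: cvg_id|exact: cvg_cst].
    by split; [apply: (continuous_comp cs rA)|apply: (continuous_comp cs iA)].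
  have [rA iA] := cA u u0.
  split; rewrite /re_fun /im_fun.
    rewrite (_ : (fun x => _) = - re_fun A); first exact: continuousN.
    by apply/funext => x; rewrite ReN.
  rewrite (_ : (fun x => _) = - im_fun A); first exact: continuousN.
  by apply/funext => x; rewrite ImN.
have main (a1 b1 : R) : 0 < a1 -> a1 < b1 -> exists b W, [/\ forall u, a1 < u < b1 -> 0 < b u,
    forall u, is_cderive W u (D u * (b u)%:C) & W a1 = W b1].
  move=> a0 ab; have [b [k bk]] := shifted_bump_exists ab M0.
  have [sb b0 bp sk _] := bk.
  have [X [V [dX dV XV]]] := shift_primitives a0 M0 bk cA.
  have [B dB] := primitive (smooth_continuous sb).
  exists b, (fun u => V u - (M%:C * kk) * (B u)%:C); split=> //.
    move=> u; apply: (is_cderive_eq (is_cderiveB (dV u) (is_cderiveZ (M%:C * kk) (is_cderive_real (dB u))))).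
    by rewrite /D; ring.
  have E1 := translate_test a0 ab M0 bk.
  rewrite (cusp_pairing HT cphi _ beta0 a0 ab M0 bk dJ (fun u _ => dX u)) in E1.
  rewrite (fourier_pairing (sg * rR) a0 ab M0 beta0 bk N0 MN Hfou dB) sgbeta XV in E1.
  have E2 : V b1 - V a1 = (sg * sg ^+ delta)%:C * (cg 0 * (N%:R * (B b1 - B a1))%:C).
    transitivity ((sg * sg)%:C * (sg ^+ delta * sg ^+ delta)%:C * (V b1 - V a1)).
      by rewrite sgsg sgd !mul1r.
    by rewrite E1 !realCM; ring.
  have E3 : V b1 = V a1 + (sg * sg ^+ delta)%:C * (cg 0 * (N%:R * (B b1 - B a1))%:C).
    by rewrite -E2; ring.
  rewrite E3 /kk /M !realCM realCD rmorphN; field.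
  by rewrite intr_eq0 gt_eqF.
move=> u u0; apply/eqP; rewrite -subr_eq0 -/(D u); apply/eqP.
apply: eqC.
- apply: (@fundamental_lemma R (re_fun D)) => // [v /cD []//|a1 b1 a0 ab].
  have [b [W [bp dW WW]]] := main a1 b1 a0 ab.
  exists b, (re_fun W); split=> //; last by rewrite /re_fun WW.
  by move=> v; have [+ _] := dW v; rewrite ReM /= mulr0 subr0.
- apply: (@fundamental_lemma R (im_fun D)) => // [v /cD []//|a1 b1 a0 ab].
  have [b [W [bp dW WW]]] := main a1 b1 a0 ab.
  exists b, (im_fun W); split=> //; last by rewrite /im_fun WW.
  by move=> v; have [_ +] := dW v; rewrite ImM /= mulr0 add0r.
Qed.

End Relation.

(** A test function built from a bump and its shift by [N] sees only the constant coefficient, with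
    the nonzero factor [N] times the integral of the bump. *)
Lemma fourier_constant_unique (T S : functional R) (N : nat) (c c' : int -> R[i]) :
  (0 < N)%N -> eq_on setT T S -> fourier_series N T c -> fourier_series N S c' ->
  c 0 = c' 0.
Proof.
move=> N0 TS HT HS.
have M0 : 0 < (N%:R : R) by rewrite ltr0n.
have [b [k bk]] := @shifted_bump_exists R 1 2 _ (ltac:(lra)) M0.
have [sb b0 bp sk _] := bk.
have [B dB] := primitive (smooth_continuous sb).
have o0 : 1 != 0 :> R by exact: oner_neq0.
have ME : (N%:R : R) = `|1| * N%:R by rewrite normr1 mul1r.
have l12 : (1 : R) < 2 by lra.
have [tf _] := affine_test 0 l12 M0 o0 bk.
have := fourier_pairing 0 ltr01 l12 M0 o0 bk N0 ME HT dB.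
rewrite TS//; rewrite (fourier_pairing 0 ltr01 l12 M0 o0 bk N0 ME HS dB).
have [x /andP[x1 x2] E] := mean_value l12 (fun x _ => dB x).
have nz : (N%:R * (B 2 - B 1))%:C != 0 :> R[i].
  apply/eqP => -[] /eqP; rewrite E !mulf_eq0 (gt_eqF M0) gt_eqF/=; last by apply: bp; rewrite x1.
  by move=> /eqP; lra.
by move=> /(mulIf nz) ->.
Qed.

End TranslateRelation.

(** * Difference quotients along x0 - 1 / (beta u) *)

Section DifferenceQuotients.
Variable R : realType.
Implicit Types (psi : R -> R) (x y u : R).

(** Comparing two points a period apart kills the slope; periodicity then carries the constant to
    the whole line. *)
Lemma half_line_constant (a : R) psi (P x0 C : R) : 0 < P ->
  (forall y, psi (y + P) = psi y) -> (forall y, y < x0 -> a * y + psi y = C) ->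
  a = 0 /\ forall y, psi y = C.
Proof.
move=> P0 per H.
have a0 : a = 0.
  have H1 := H (x0 - 1) ltac:(lra); have H2 := H (x0 - 1 - P) ltac:(lra).
  have H3 := per (x0 - 1 - P); rewrite subrK in H3.
  have : a * P = 0 by rewrite H3 in H1; lra.
  by move=> /eqP; rewrite mulf_eq0 (gt_eqF P0) orbF => /eqP.
split=> // y; pose n := Num.truncn (`|y - x0| / P).
have yn : y - n.+1%:R * P < x0.
  have := truncnS_gt (`|y - x0| / P); rewrite -/n ltr_pdivrMr//.
  have := ler_norm (y - x0); lra.
have := H _ yn; rewrite a0 mul0r add0r => <-.
elim: n.+1 => [|m IH]; first by rewrite mul0r subr0.
rewrite IH -natr1 mulrDl mul1r opprD addrA.
by rewrite -[in LHS](subrK P (y - m%:R * P)) per.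
Qed.

Lemma cvg_inv_line (x0 beta : R) : x0 - (beta * u)^-1 @[u --> +oo] --> x0.
Proof.
rewrite -[X in _ --> X]subr0; apply: cvgB; first exact: cvg_cst.
rewrite -(mulr0 beta^-1) (_ : (fun u => _) = fun u => beta^-1 * u^-1); last first.
  by apply/funext => u; rewrite invfM.
apply: cvgM; first exact: cvg_cst.
have H := cvg_decay 1 (@ltr01 R); apply: cvg_trans H.
apply: near_eq_cvg; near=> u.
have u0 : 0 < u by near: u; apply: nbhs_pinfty_gt; exact: num_real.
apply: (mulfI (lt0r_neq0 u0)); rewrite mulfV ?gt_eqF// mul1r.
by rewrite -[X in decay X](add0r 1) decayM// decay0.
Unshelve. all: by end_near. Qed.

Lemma derivable_limit psi (x0 beta : R) : beta != 0 -> derivable psi x0 1 ->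
  exists L : R, u * (psi (x0 - (beta * u)^-1) - psi x0) @[u --> +oo] --> L.
Proof.
move=> b0 /derivableP /is_derive1_caratheodory [g [Hg cg _]].
exists (- beta^-1 * g x0).
have H : - beta^-1 * g (x0 - (beta * u)^-1) @[u --> +oo] --> - beta^-1 * g x0.
  apply: cvgM; first exact: cvg_cst.
  by apply: continuous_cvg; [exact: cg|exact: cvg_inv_line].
apply: cvg_trans H; apply: near_eq_cvg; near=> u.
have u0 : 0 < u by near: u; apply: nbhs_pinfty_gt; exact: num_real.
by rewrite Hg; field; rewrite b0 gt_eqF.
Unshelve. all: by end_near. Qed.

(** A point [z] near [x0] has parameter u = 1 / (q |z - x0|), with [sg] opposite to the sign of
    [z - x0]; its slope is, in absolute value, [q] times the quantity that tends to 0. *)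
Lemma limit_derivable psi (x0 q : R) : 0 < q ->
  (forall sg : R, sg = 1 \/ sg = -1 ->
     u * (psi (x0 - (sg * q * u)^-1) - psi x0) @[u --> +oo] --> (0 : R)) ->
  is_derive x0 1 psi 0.
Proof.
move=> q0 H; apply/is_derive1_caratheodory.
pose g z := if z == x0 then 0 else (psi z - psi x0) / (z - x0).
exists g; split.
- move=> z; rewrite /g; case: eqP => [->|/eqP zx]; first by rewrite !subrr mulr0.
  by rewrite divfK// subr_eq0.
- rewrite /prop_for /continuous_at {2}/g eqxx; apply/cvgrPdist_lt => e e0.
  have eq0 : 0 < e / q by rewrite divr_gt0.
  have /cvgrPdist_lt /(_ _ eq0) [T1 [_ HT1]] := H 1 (or_introl erefl).
  have /cvgrPdist_lt /(_ _ eq0) [T2 [_ HT2]] := H (-1) (or_intror erefl).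
  pose T := 1 + `|T1| + `|T2|.
  have T0 : 0 < T by rewrite /T; have := normr_ge0 T1; have := normr_ge0 T2; lra.
  have T1T : T1 < T by rewrite /T; have := ler_norm T1; have := normr_ge0 T2; lra.
  have T2T : T2 < T by rewrite /T; have := ler_norm T2; have := normr_ge0 T1; lra.
  (* Points closer to [x0] than this have their parameter [u] beyond both thresholds. *)
  have d0 : 0 < (q * T)^-1 by rewrite invr_gt0 mulr_gt0.
  have := @nbhsx_ballx R R x0 _ d0; apply: filterS => z; rewrite /ball/= => zd.
  rewrite sub0r normrN /g; case: eqP => [_|/eqP zx]; first by rewrite normr0.
  have zx0 : z - x0 != 0 by rewrite subr_eq0.
  have nz : 0 < `|z - x0| by rewrite normr_gt0.
  pose u := (q * `|z - x0|)^-1.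
  have u0 : 0 < u by rewrite invr_gt0 mulr_gt0.
  have uT : T < u.
    rewrite /u -[T]invrK ltf_pV2 ?posrE ?invr_gt0// ?mulr_gt0//.
    by move: zd; rewrite distrC invfM -ltr_pdivlMl// mulrC.
  have key (sg : R) : sg = 1 \/ sg = -1 -> z - x0 = - sg * `|z - x0| ->
      x0 - (sg * q * u)^-1 = z.
    move=> s1 E; rewrite -[z in RHS](subrK x0) E /u.
    move: nz; set m := `|_| => nz.
    by case: s1 => ->; field; rewrite !gt_eqF.
  suff : `|u * (psi z - psi x0)| < e / q.
    rewrite ltr_pdivlMr//.
    suff -> : `|(psi z - psi x0) / (z - x0)| = `|u * (psi z - psi x0)| * q by [].
    rewrite !normrM normfV (gtr0_norm u0) /u; field.
    by rewrite !gt_eqF.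
  have [zp|zn] := leP 0 (z - x0).
    have := HT2 u (lt_trans T2T uT); rewrite sub0r normrN key//; first by right.
    by rewrite opprK mul1r ger0_norm.
  have := HT1 u (lt_trans T1T uT); rewrite sub0r normrN key//; first by left.
  by rewrite ltr0_norm// mulN1r opprK.
- by rewrite /g eqxx.
Qed.

End DifferenceQuotients.

(** * One-sided behaviour at a rational point *)

Section RationalPoint.
Variable R : realType.
Local Open Scope complex_scope.
Local Notation Re := complex.Re.
Local Notation Im := complex.Im.
Variables (lam : R[i]) (delta : 'Z_2) (tau gtau : dist_pair R).
Variables (N : nat) (c0 : R[i]) (cg : int -> R[i]) (phi : R -> R[i]).
Variables (p q r s : int) (om : R[i]).
Hypothesis HT : eq_on setT tau.1 (dist_add (dist_of (fun=> c0)) (dist_deriv (dist_of phi))).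
Hypothesis cphi : forall x, ccontinuous phi x.
Hypotheses (N0 : (0 < N)%N) (q0 : 0 < q) (det1 : p * r - q * s = 1).
Hypothesis Htr : translate lam delta (mx2 r (- s) (- q) p) tau gtau.
Hypothesis Hfou : fourier_series N gtau.1 cg.
Hypothesis lam1 : -1 < Re lam.
Hypothesis cg0 : cg 0 = 0 \/ 0 < Re lam.

Let rho x := c0 * x%:C + phi x.
Let x0 : R := p%:~R / q%:~R.
Let qR0 : 0 < (q%:~R : R). Proof. by rewrite ltr0z. Qed.

Section Side.
Variable sg : R.
Hypothesis sg1 : sg = 1 \/ sg = -1.
Let beta := sg * q%:~R.
(** The relation for [A] is complex linear and survives the factor [om], so that one treatment of
    [Re] covers both parts. *)
Let f u := om * rho (x0 - (beta * u)^-1).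
Let M : R := q%:~R * N%:R.
(** [lam * nu] is kappa times [om]. For [lam = 0] the division returns 0, which is the right value
    because [cg 0] then vanishes. *)
Let nu := om * ((sg * sg ^+ delta)%:C * cg 0 / (q%:~R)%:C / lam).

Let sg0 : sg != 0. Proof. by case: sg1 => ->; rewrite ?oppr_eq0 oner_eq0. Qed.
Let qn0 : q%:~R != 0 :> R. Proof. by rewrite gt_eqF ?qR0. Qed.
Let beta0 : beta != 0. Proof. exact: mulf_neq0 sg0 qn0. Qed.
Let M0 : 0 < M. Proof. by apply: mulr_gt0; [exact: qR0|rewrite ltr0n]. Qed.

Let lam_nu : lam * nu = om * ((sg * sg ^+ delta)%:C * cg 0 / (q%:~R)%:C).
Proof.
rewrite /nu; have [l0|l0] := eqVneq lam 0.
  by case: cg0 => [->|]; rewrite ?l0 ?ltxx// mulr0 !mul0r mulr0.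
by rewrite mulrCA [lam * _]mulrC divfK.
Qed.

Let nu0 : nu = 0 \/ 0 < Re lam.
Proof. by case: cg0 => [H|]; [left; rewrite /nu H mulr0 !mul0r mulr0|right]. Qed.

Let cf u : 0 < u -> ccontinuous f u.
Proof.
move=> u0; have bu : beta * u != 0 by apply: mulf_neq0 beta0 _; rewrite gt_eqF.
have cY : {for u, continuous (fun u => x0 - (beta * u)^-1)}.
  apply: continuousB; first exact: cvg_cst.
  by apply: (continuousV bu); apply: mulrl_continuous.
apply: ccontinuousM; first exact: is_cderive_continuous (is_cderive_cst om u).
have [rc ic] := ccontinuous_rho c0 cphi (x0 - (beta * u)^-1).
by split; [apply: (continuous_comp cY rc)|apply: (continuous_comp cY ic)].
Qed.

Let ctf : ctends f (om * rho x0).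
Proof.
have [rc ic] := ccontinuous_rho c0 cphi x0.
have H := @cvg_inv_line R x0 beta.
have Hr := cvg_comp _ _ H rc; have Hi := cvg_comp _ _ H ic.
split; rewrite ?ReM ?ImM.
- rewrite (_ : re_fun f = fun u => Re om * re_fun rho (x0 - (beta * u)^-1) - Im om * im_fun rho (x0 - (beta * u)^-1)).
    by apply: cvgB; apply: cvgM; [exact: cvg_cst|exact: Hr|exact: cvg_cst|exact: Hi].
  by apply/funext => u; rewrite /re_fun /f ReM.
- rewrite (_ : im_fun f = fun u => Re om * im_fun rho (x0 - (beta * u)^-1) + Im om * re_fun rho (x0 - (beta * u)^-1)).
    by apply: cvgD; apply: cvgM; [exact: cvg_cst|exact: Hi|exact: cvg_cst|exact: Hr].
  by apply/funext => u; rewrite /im_fun /f ImM.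
Qed.

Let relation : exists J, (forall u, 0 < u -> is_cderive J u (cpower u lam * f u)) /\
  forall u, 0 < u -> (cpower (u + M) (lam + 1) * f (u + M) - (lam + 1) * J (u + M)) -
    (cpower u (lam + 1) * f u - (lam + 1) * J u) = M%:C * (lam * nu).
Proof.
have YE u : (sg * p%:~R - u^-1) / (sg * q%:~R) = x0 - (beta * u)^-1.
  have E : sg * p%:~R / (sg * q%:~R) = x0 by rewrite /x0; field; rewrite qn0 sg0.
  by rewrite mulrBl E [in RHS]invfM [in RHS]mulrC.
pose f1 u := c0 * ((sg * p%:~R - u^-1) / (sg * q%:~R))%:C + phi ((sg * p%:~R - u^-1) / (sg * q%:~R)).
have fE u : f u = om * f1 u by rewrite /f1 YE.
have cf1 u : 0 < u -> ccontinuous f1 u.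
  move=> u0; have bu : beta * u != 0 by apply: mulf_neq0 beta0 _; rewrite gt_eqF.
  have cY : {for u, continuous (fun u => x0 - (beta * u)^-1)}.
    apply: continuousB; first exact: cvg_cst.
    by apply: (continuousV bu); apply: mulrl_continuous.
  have [rc ic] := ccontinuous_rho c0 cphi (x0 - (beta * u)^-1).
  rewrite (_ : f1 = fun u => rho (x0 - (beta * u)^-1)); last by apply/funext => v; rewrite /f1 YE.
  by split; [apply: (continuous_comp cY rc)|apply: (continuous_comp cY ic)].
have [J dJ] := @cprimitive_pos _ (fun u => cpower u lam * f1 u)
   (fun u u0 => ccontinuousM (is_cderive_continuous (is_cderive_cpower lam u0)) (cf1 u u0)).
exists (fun u => om * J u); split=> [u u0|u u0].
  by apply: (is_cderive_eq (is_cderiveZ om (dJ u u0))); rewrite fE; ring.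
have E : cpower (u + M) (lam + 1) * f1 (u + M) - (lam + 1) * J (u + M) -
    (cpower u (lam + 1) * f1 u - (lam + 1) * J u) =
    M%:C * ((sg * sg ^+ delta)%:C * cg 0 / (q%:~R)%:C).
  exact: (translate_relation HT cphi N0 q0 det1 Htr Hfou sg1 dJ u0).
rewrite lam_nu !fE.
by rewrite [RHS]mulrCA -E; ring.
Qed.

Let W u := u * (Re (om * rho (x0 - (beta * u)^-1)) - Re (om * rho x0)).

Let WE : (fun u => u * Re (f u - om * rho x0)) = W.
Proof. by apply/funext => u; rewrite ReD ReN. Qed.

Let Re_nu : Im lam = 0 ->
  Re nu = sg * sg ^+ delta / q%:~R / Re lam * Re (om * cg 0).
Proof.
move=> l0.
have lE : lam = (Re lam)%:C by apply: eqC.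
have -> : nu = (sg * sg ^+ delta / q%:~R / Re lam)%:C * (om * cg 0).
  rewrite /nu [in LHS]lE !realCM !realCV; ring.
by rewrite ReM /= mul0r subr0.
Qed.

Lemma side_limit_zero : Im lam = 0 -> 0 < Re lam -> Re (om * cg 0) = 0 ->
  W u @[u --> +oo] --> (0 : R).
Proof.
move=> l0 lp c00; have [J [dJ HA]] := relation.
rewrite -WE; apply: (cusp_differentiable M0 lam1 nu0 cf ctf dJ HA l0 lp).
by rewrite Re_nu// c00 mulr0.
Qed.

Lemma side_limit_constant (L : R) : Im lam = 0 -> 0 < Re lam -> Re lam < 1 ->
  W u @[u --> +oo] --> L -> Re (om * cg 0) = 0.
Proof.
move=> l0 lp ll; have [J [dJ HA]] := relation.
rewrite -WE => HW.
have := cusp_not_differentiable M0 lam1 nu0 cf ctf dJ HA l0 lp ll HW.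
rewrite Re_nu// => /eqP; rewrite mulf_eq0 => /orP[|/eqP//].
rewrite !mulf_eq0 !invr_eq0 (gt_eqF qR0) (gt_eqF lp) !orbF expf_eq0 (negbTE sg0) andbF.
by [].
Qed.

Lemma side_real_rigid (L : R) : Im lam = 0 -> Re lam <= 0 ->
  W u @[u --> +oo] --> L ->
  forall u v, 0 < u -> 0 < v -> Re (f u) = Re (f v).
Proof.
move=> l0 ln; have [J [dJ HA]] := relation.
rewrite -WE; exact: (cusp_real_rigid M0 lam1 nu0 cf ctf dJ HA l0 ln).
Qed.

Lemma side_imaginary_rigid (L : R) : Re lam = 0 -> Im lam != 0 ->
  W u @[u --> +oo] --> L ->
  forall u v, 0 < u -> 0 < v -> f u = f v.
Proof.
move=> l0 ln; have [J [dJ HA]] := relation.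
rewrite -WE; exact: (cusp_imaginary_rigid M0 lam1 nu0 cf ctf dJ HA l0 ln).
Qed.

End Side.
End RationalPoint.

(** * From one-sided limits to the antiderivative and the distribution *)

Section Conclusions.
Variable R : realType.
Local Open Scope complex_scope.
Local Notation Re := complex.Re.
Local Notation Im := complex.Im.
Variables (lam : R[i]) (delta : 'Z_2) (tau : dist_pair R).
Variables (N : nat) (c0 : R[i]) (phi : R -> R[i]).
Hypothesis HT : eq_on setT tau.1 (dist_add (dist_of (fun=> c0)) (dist_deriv (dist_of phi))).
Hypothesis cphi : forall x, ccontinuous phi x.
Hypothesis perphi : forall x, phi (x + N%:R) = phi x.
Hypothesis (N0 : (0 < N)%N).

Let rho x := c0 * x%:C + phi x.
Let NR0 : 0 < (N%:R : R). Proof. by rewrite ltr0n. Qed.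

(** For real [f] the pairing is minus the integral of f' times [Re (om * rho)], which is the
    constant [C]; and f' integrates to 0. *)
Lemma real_part_vanishes (om : R[i]) (C : R) : Re (om * c0) = 0 ->
  (forall y, Re (om * phi y) = C) ->
  forall f, test_function f -> (forall x, Im (f x) = 0) -> Re (om * tau.1 f) = 0.
Proof.
move=> a0 HC f tf fi.
have [sr si [a aa f0]] := test_functionP tf.
have [P dP] := cprimitive (fun t => ccontinuousM (ccontinuous_rho c0 cphi t) (test_ccontinuous1 tf t)).
have naa : - a - 1 < a + 1 by lra.
have f0' t : ~~ (- a - 1 < t < a + 1) -> f t = 0.
  by move=> H; apply: f0; apply: contra H => /andP[? ?]; apply/andP; split; lra.
rewrite (pairing_primitive HT cphi tf naa f0' dP).
have dfi t : Im (cderiven 1 f t) = 0.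
  have [_ H] := test_cderive tf t.
  rewrite (_ : im_fun f = cst 0) in H; last by apply/funext => x; exact: fi.
  by have [_ <-] := H; have [_ ->] := is_derive_cst (0 : R) t (1 : R).
have Crho y : Re (om * (c0 * y%:C + phi y)) = C.
  by rewrite mulrDr ReD HC mulrA ReM a0 /= mulr0 mul0r subrr add0r.
have : Re (om * P (- a - 1)) - C * re_fun f (- a - 1) = Re (om * P (a + 1)) - C * re_fun f (a + 1).
  apply: (@derive0_eq _ (fun t => Re (om * P t) - C * re_fun f t)); first exact: ltW.
  move=> t _.
  have [d1 _] := is_cderiveZ om (dP t).
  have [d2 _] := is_cderiveZ C%:C (test_cderive tf t).
  have := is_deriveB d1 d2.
  have -> : Re (om * ((c0 * t%:C + phi t) * cderiven 1 f t)) - Re (C%:C * cderiven 1 f t) = 0.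
    by rewrite mulrA ReM Crho dfi mulr0 subr0 ReM /= mul0r subr0 subrr.
  rewrite (_ : _ - _ = (fun t => Re (om * P t) - C * re_fun f t))//.
  by apply/funext => x /=; rewrite !fctE /re_fun [Re (C%:C * _)]ReM /= mul0r subr0.
rewrite /re_fun !f0' /= ?mulr0 ?subr0; last 2 first.
- by rewrite negb_and -!leNgt lexx orbT.
- by rewrite negb_and -!leNgt lexx.
by rewrite mulrBr ReD ReN => ->; rewrite subrr.
Qed.

Lemma constant_vanishes (C : R[i]) : c0 = 0 -> (forall y, phi y = C) -> vanishes tau.1.
Proof.
move=> c00 HC f tf _.
have [sr si [a aa f0]] := test_functionP tf.
have dP t : is_cderive (fun t => C * f t) t ((c0 * t%:C + phi t) * cderiven 1 f t).
  by rewrite c00 mul0r add0r HC; exact: is_cderiveZ (test_cderive tf t).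
have naa : - a - 1 < a + 1 by lra.
have f0' t : ~~ (- a - 1 < t < a + 1) -> f t = 0.
  by move=> H; apply: f0; apply: contra H => /andP[? ?]; apply/andP; split; lra.
rewrite (pairing_primitive HT cphi tf naa f0' dP) !f0' ?mulr0 ?subrr//.
- by rewrite negb_and -!leNgt lexx orbT.
- by rewrite negb_and -!leNgt lexx.
Qed.

Variables (gtau : dist_pair R) (cg : int -> R[i]) (p q r s : int).
Hypotheses (q0 : 0 < q) (det1 : p * r - q * s = 1).
Hypothesis Htr : translate lam delta (mx2 r (- s) (- q) p) tau gtau.
Hypothesis Hfou : fourier_series N gtau.1 cg.

Let x0 : R := p%:~R / q%:~R.
Let qR0 : 0 < (q%:~R : R). Proof. by rewrite ltr0z. Qed.

(** The increments of [A] are computed from [tau] alone and determine the constant coefficient,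
    whichever translate and series are chosen; the single point [u = 1] suffices. *)
Lemma translate_constant_unique gtau' cg' :
  translate lam delta (mx2 r (- s) (- q) p) tau gtau' ->
  fourier_series N gtau'.1 cg' -> cg' 0 = cg 0.
Proof.
move=> Htr' Hfou'.
pose f1 (u : R) := c0 * ((1 * p%:~R - u^-1) / (1 * q%:~R))%:C + phi ((1 * p%:~R - u^-1) / (1 * q%:~R)).
have cf1 u : 0 < u -> ccontinuous f1 u.
  move=> u0; have un0 : u != 0 by rewrite gt_eqF.
  have cY : {for u, continuous (fun u : R => (1 * p%:~R - u^-1) / (1 * q%:~R))}.
    apply: continuousM; last exact: cvg_cst.
    by apply: continuousB; [exact: cvg_cst|apply: inv_continuous].
  have [rc ic] := ccontinuous_rho c0 cphi ((1 * p%:~R - u^-1) / (1 * q%:~R)).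
  by split; [apply: (continuous_comp cY rc)|apply: (continuous_comp cY ic)].
have [J dJ] := @cprimitive_pos _ (fun u => cpower u lam * f1 u)
   (fun u u0 => ccontinuousM (is_cderive_continuous (is_cderive_cpower lam u0)) (cf1 u u0)).
have E1 := translate_relation HT cphi N0 q0 det1 Htr Hfou (or_introl erefl) dJ ltr01.
have E2 := translate_relation HT cphi N0 q0 det1 Htr' Hfou' (or_introl erefl) dJ ltr01.
have MC : (q%:~R * N%:R : R)%:C != 0 :> R[i].
  by apply/eqP => -[] /eqP; rewrite mulf_eq0 (gt_eqF qR0) (gt_eqF NR0).
have qC : (q%:~R : R)%:C != 0 :> R[i] by apply/eqP => -[] /eqP; rewrite (gt_eqF qR0).
have := etrans (esym E2) E1; rewrite expr1n !mul1r => /(mulfI MC).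
by move/(mulIf (invr_neq0 qC)).
Qed.

Hypothesis lam1 : -1 < Re lam.
Hypothesis cg0 : cg 0 = 0 \/ 0 < Re lam.

(* [om = 1] and [om = -i] give the real and the imaginary part of [phi]. *)
Variable om : R[i].
Let psi y := Re (om * phi y).

Let rhoE y : Re (om * rho y) = Re (om * c0) * y + psi y.
Proof. by rewrite /rho mulrDr ReD mulrA [Re (om * c0 * _)]ReM /= mulr0 subr0. Qed.

Let dlin (y : R) : is_derive y 1 (fun y => Re (om * c0) * y) (Re (om * c0)).
Proof.
apply: (is_derive_eq (@is_deriveZ _ _ _ id (Re (om * c0)) y 1 _ (is_derive_id y 1))).
by rewrite /GRing.scale/= mulr1.
Qed.

Lemma point_is_derive : Im lam = 0 -> 0 < Re lam -> Re (om * cg 0) = 0 ->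
  is_derive x0 1 psi (- Re (om * c0)).
Proof.
move=> l0 lp c00.
have d0 : is_derive x0 1 (fun y => Re (om * rho y)) 0.
  apply: (limit_derivable qR0) => sg sg1.
  exact: (side_limit_zero HT cphi N0 q0 det1 Htr Hfou lam1 cg0 sg1 l0 lp c00).
have := is_deriveB d0 (dlin x0); rewrite sub0r.
rewrite (_ : _ - _ = psi)//; apply/funext => y.
by rewrite !fctE rhoE addrAC subrr add0r.
Qed.

Lemma point_limit : derivable psi x0 1 -> exists L : R,
  (fun u => u * (Re (om * rho (x0 - (1 * q%:~R * u)^-1)) - Re (om * rho x0))) u @[u --> +oo] --> L.
Proof.
move=> dpsi.
have d0 : derivable (fun y => Re (om * rho y)) x0 1.
  have [dl _] := dlin x0; have := derivableD dl dpsi.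
  by rewrite (_ : _ + _ = (fun y => Re (om * rho y)))//; apply/funext => y; rewrite rhoE.
apply: (derivable_limit _ d0).
by rewrite mul1r gt_eqF ?qR0.
Qed.

Lemma point_derivable_pos : Im lam = 0 -> 0 < Re lam -> Re lam < 1 ->
  derivable psi x0 1 -> Re (om * cg 0) = 0.
Proof.
move=> l0 lp ll /point_limit[L HL].
exact: (side_limit_constant HT cphi N0 q0 det1 Htr Hfou lam1 cg0 (or_introl erefl) l0 lp ll HL).
Qed.

(** The side [sg = 1] covers the whole half-line left of [x0]. *)
Let reach y : y < x0 -> exists2 u, 0 < u & x0 - (1 * q%:~R * u)^-1 = y.
Proof.
move=> yx; exists (q%:~R * (x0 - y))^-1.
  by rewrite invr_gt0; apply: mulr_gt0; [exact: qR0|rewrite subr_gt0].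
have n1 : q%:~R != 0 :> R by rewrite gt_eqF ?qR0.
have n2 : x0 - y != 0 by rewrite subr_eq0 gt_eqF.
have -> : (1 * q%:~R * (q%:~R * (x0 - y))^-1)^-1 = x0 - y by field; rewrite n1 n2.
by rewrite subKr.
Qed.

Lemma point_derivable_rigid : Im lam = 0 -> Re lam <= 0 -> derivable psi x0 1 ->
  Re (om * c0) = 0 /\ exists C, forall y, psi y = C.
Proof.
move=> l0 ln /point_limit[L HL].
have H := side_real_rigid HT cphi N0 q0 det1 Htr Hfou lam1 cg0 (or_introl erefl) l0 ln HL.
pose C := Re (om * rho (x0 - (1 * q%:~R * 1)^-1)).
have HC y : y < x0 -> Re (om * c0) * y + psi y = C.
  by move=> /reach[u u0 <-]; rewrite -rhoE; exact: H.
have [-> K] := half_line_constant NR0 (fun y => congr1 (fun z => Re (om * z)) (perphi y)) HC.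
by split=> //; exists C.
Qed.

(** Rigidity here concerns the complex function [om * rho] and not only its real part, so [om] can
    be cancelled and both parts of [rho] are constant. *)
Lemma point_derivable_imaginary : om != 0 -> Re lam = 0 -> Im lam != 0 ->
  derivable psi x0 1 -> vanishes tau.1.
Proof.
move=> om0 l0 ln /point_limit[L HL].
have H := side_imaginary_rigid HT cphi N0 q0 det1 Htr Hfou lam1 cg0 (or_introl erefl) l0 ln HL.
pose C := rho (x0 - (1 * q%:~R * 1)^-1).
have HC y : y < x0 -> rho y = C.
  by move=> /reach[u u0 <-]; apply: (mulfI om0); exact: H.
have HR y : y < x0 -> Re c0 * y + Re (phi y) = Re C.
  by move=> /HC <-; rewrite ReD ReM /= mulr0 subr0.
have HI y : y < x0 -> Im c0 * y + Im (phi y) = Im C.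
  by move=> /HC <-; rewrite ImD ImM /= mulr0 add0r.
have [r0 rC] := half_line_constant NR0 (fun y => congr1 (fun z : R[i] => Re z) (perphi y)) HR.
have [i0 iC] := half_line_constant NR0 (fun y => congr1 (fun z : R[i] => Im z) (perphi y)) HI.
apply: (@constant_vanishes C); first exact: eqC.
by move=> y; apply: eqC; rewrite ?rC ?iC.
Qed.

End Conclusions.

(* Besides the exceptional situation lambda > 0, Re (cg 0) = 0 one must exclude
   real lambda <= 0 with Re tau = 0 (resp. Im tau = 0): there tau may be nonzero
   although Re phi (resp. Im phi) is identically zero, hence differentiable. *)
Theorem corollary4p11 (R : realType) (Gamma : set 'M[int]_2) (N : nat)
    (lambda : R[i]) (delta : 'Z_2)
    (tau : dist_pair R) (c : int -> R[i]) (phi : R -> R[i])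
    (hGamma : normal_finite_index_subgroup Gamma)
    (hN : (0 < N)%N)
    (hwidth : forall n : int, Gamma (mx2 1 n 0 1) <-> (N%:Z %| n)%Z)
    (hparam : admissible_parameters lambda delta)
    (haut : automorphic Gamma lambda delta tau)
    (hnat : natural_extension N lambda delta tau)
    (hc : fourier_series N tau.1 c)
    (hphi : normalized_antiderivative N tau.1 (c 0) phi)
    (hnz : ~ vanishes tau.1) :
  (forall (p q r s : int) (gtau : dist_pair R) (cg : int -> R[i]),
     coprimez p q -> 0 < q -> p * r - q * s = 1 ->
     translate lambda delta (mx2 r (- s) (- q) p) tau gtau ->
     fourier_series N gtau.1 cg ->
     let x : R := p%:~R / q%:~R in
     [/\ ~ (0 < lambda /\ complex.Re (cg 0) = 0) ->
         ~ (lambda <= 0 /\ re_vanishes tau.1) ->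
         ~ derivable (re_fun phi) x 1,
         ~ (0 < lambda /\ complex.Im (cg 0) = 0) ->
         ~ (lambda <= 0 /\ im_vanishes tau.1) ->
         ~ derivable (im_fun phi) x 1,
         0 < lambda -> complex.Re (cg 0) = 0 ->
         is_derive x 1 (re_fun phi) (- complex.Re (c 0)) &
         0 < lambda -> complex.Im (cg 0) = 0 ->
         is_derive x 1 (im_fun phi) (- complex.Im (c 0))])
  /\
  (0 < lambda -> cuspidal N lambda delta tau ->
   forall a : rat, is_derive (ratr a : R) 1 (re_fun phi) 0 /\
                   is_derive (ratr a : R) 1 (im_fun phi) 0).
Proof.
have [[crphi ciphi] perphi HT _] := hphi.
have cphi x : ccontinuous phi x by split; [exact: crphi|exact: ciphi].
have lamE : (0 < lambda) = (complex.Im lambda == 0) && (0 < complex.Re lambda) by rewrite ltcE.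
have lamE' : (lambda <= 0) = (0 == complex.Im lambda) && (complex.Re lambda <= 0) by rewrite lecE.
have lam1 : -1 < complex.Re lambda.
  case: hparam => [->|[_ [[+ _]|[+ _]]]]; first by rewrite ltrN10.
  - by rewrite ltcE /= => /andP[].
  - by rewrite ltcE /= => /andP[_]; apply: lt_trans; exact: ltrN10.
have lamlt1 : complex.Re lambda < 1.
  case: hparam => [->|[_ [[_ +]|[_ +]]]]; first exact: ltr01.
  - by rewrite ltcE /= => /andP[_ h]; exact: lt_trans h ltr01.
  - by rewrite ltcE /= => /andP[].
have lampos : 0 < complex.Re lambda -> complex.Im lambda = 0.
  case: hparam => [->|[_ [[_ +]|[+ _]]]]; first by rewrite ltxx.
  - by rewrite ltcE /= => /andP[/eqP <-].
  - by rewrite ltcE /= => /andP[/eqP ->].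
have lamimag : complex.Im lambda != 0 -> complex.Re lambda = 0.
  case: hparam => [//|[_ [[_ +]|[+ _]]]].
  - by rewrite ltcE /= => /andP[/eqP <-]; rewrite eqxx.
  - by rewrite ltcE /= => /andP[/eqP ->]; rewrite eqxx.
have om1 (F : R -> R[i]) : re_fun F = (fun y => complex.Re (1 * F y)).
  by apply/funext => y; rewrite mul1r.
have omi (z : R[i]) : complex.Re (Complex 0 (-1) * z) = complex.Im z.
  by rewrite ReM /= mul0r mulN1r sub0r opprK.
have omiF (F : R -> R[i]) : im_fun F = (fun y => complex.Re (Complex 0 (-1) * F y)).
  by apply/funext => y; rewrite omi.
have i0 : (Complex 0 (-1) : R[i]) != 0 by apply/eqP => -[] /eqP; rewrite oppr_eq0 oner_eq0.
(* The multipliers 1 and -i give the two parts of the theorem. The disjunction is the contrapositive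
   of the claim of non-differentiability, each exception being one alternative. *)
have main (p q r s : int) (gtau : dist_pair R) (cg : int -> R[i]) :
    0 < q -> p * r - q * s = 1 ->
    translate lambda delta (mx2 r (- s) (- q) p) tau gtau ->
    fourier_series N gtau.1 cg ->
    let x : R := p%:~R / q%:~R in forall om : R[i], om != 0 ->
    [/\ derivable (fun y => complex.Re (om * phi y)) x 1 ->
          (0 < lambda /\ complex.Re (om * cg 0) = 0) \/
          (lambda <= 0 /\ (forall f, test_function f ->
             (forall x, complex.Im (f x) = 0) -> complex.Re (om * tau.1 f) = 0)) &
        0 < lambda -> complex.Re (om * cg 0) = 0 ->
          is_derive x 1 (fun y => complex.Re (om * phi y)) (- complex.Re (om * c 0))].
  move=> q0 det1 Htr Hfou x om om0.
  have cg0 : cg 0 = 0 \/ 0 < complex.Re lambda.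
    have [|lp] := boolP (0 < complex.Re lambda); first by right.
    (* Condition (i) holds for the translate and the series supplied by [hnat]; uniqueness of the
       constant coefficient carries it to the given ones. *)
    left; have [s' [Htr' [cs [Hfou' cs0 _]]]] := hnat.1 _ (SL2Z_mx2 det1).
    rewrite -(translate_constant_unique HT cphi hN q0 det1 Htr Hfou Htr' Hfou').
    by apply: cs0; exact/negP.
  split.
  - move=> dphi; have [lp|ln] := ltP 0 (complex.Re lambda).
      left; split; first by rewrite lamE lp lampos ?eqxx.
      exact: (point_derivable_pos HT cphi hN q0 det1 Htr Hfou lam1 cg0 (lampos lp) lp lamlt1 dphi).
    have [l0|l0] := eqVneq (complex.Im lambda) 0; last first.
      (* Off the real axis a single derivable part would make [tau] vanish altogether. *)
      case: hnz.
      exact: (point_derivable_imaginary HT cphi perphi hN q0 det1 Htr Hfou lam1 cg0 om0 (lamimag l0) l0 dphi).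
    right; split; first by rewrite lamE' l0 eqxx.
    have [a0 [C HC]] := point_derivable_rigid HT cphi perphi hN q0 det1 Htr Hfou lam1 cg0 l0 ln dphi.
    exact: (real_part_vanishes HT cphi a0 HC).
  - rewrite lamE => /andP[/eqP l0 lp] c00.
    exact: (point_is_derive HT cphi hN q0 det1 Htr Hfou lam1 cg0 l0 lp c00).
have one0 : (1 : R[i]) != 0 by exact: oner_neq0.
have part1 (p q r s : int) (gtau : dist_pair R) (cg : int -> R[i]) :
    0 < q -> p * r - q * s = 1 ->
    translate lambda delta (mx2 r (- s) (- q) p) tau gtau ->
    fourier_series N gtau.1 cg ->
    let x : R := p%:~R / q%:~R in
    (0 < lambda -> complex.Re (cg 0) = 0 -> is_derive x 1 (re_fun phi) (- complex.Re (c 0))) /\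
    (0 < lambda -> complex.Im (cg 0) = 0 -> is_derive x 1 (im_fun phi) (- complex.Im (c 0))).
  move=> q0 det1 Htr Hfou x; split=> lp c00.
  - have [_ H] := main p q r s gtau cg q0 det1 Htr Hfou 1 one0.
    by rewrite !mul1r in H; rewrite om1; exact: H.
  - have [_ H] := main p q r s gtau cg q0 det1 Htr Hfou _ i0.
    by rewrite !omi in H; rewrite omiF; exact: H.
split.
  move=> p q r s gtau cg _ q0 det1 Htr Hfou x; split.
  - move=> H1 H2 H3.
    have [+ _] := main p q r s gtau cg q0 det1 Htr Hfou 1 one0.
    rewrite -om1 mul1r => /(_ H3) [//|[l0 V]]; apply: H2; split=> // f tf fi.
    by have := V f tf fi; rewrite mul1r.
  - move=> H1 H2 H3.
    have [+ _] := main p q r s gtau cg q0 det1 Htr Hfou _ i0.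
    rewrite -omiF omi => /(_ H3) [//|[l0 V]]; apply: H2; split=> // f tf fi.
    by have := V f tf fi; rewrite omi.
  - exact: (part1 p q r s gtau cg q0 det1 Htr Hfou).1.
  - exact: (part1 p q r s gtau cg q0 det1 Htr Hfou).2.
move=> lp hcusp a.
(* Cuspidality at the identity matrix, where the weight and the Moebius map are trivial and the
   translate is [tau] itself. *)
have c00 : c 0 = 0.
  have g1 : SL2Z (1%:M : 'M[int]_2) by rewrite /SL2Z /= det1.
  have [s1 [c1 [[[_ H _] _] F1 c10]]] := hcusp _ g1.
  rewrite -c10; apply: (fourier_constant_unique hN _ hc F1) => f tf _.
  have i1 : invmx (toR R 1%:M) = 1%:M by rewrite /toR map_mx1 invmx1.
  rewrite i1 in H; have [e00 e01 e10 e11] : [/\ (1%:M : 'M[R]_2) 0 0 = 1, (1%:M : 'M[R]_2) 0 1 = 0,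
      (1%:M : 'M[R]_2) 1 0 = 0 & (1%:M : 'M[R]_2) 1 1 = 1] by split; rewrite mxE.
  rewrite (H f tf); last by move=> y _ /=; rewrite e10 e11 mul0r add0r oner_neq0.
  rewrite /slash /dist_mul /dist_moebius e00 e01 e10 e11; congr (tau.1 _); apply/funext => y.
  rewrite !mul0r !subr0 add0r expr1n invr1 mul1r mulr1.
  rewrite /weight sgr1 expr1n normr1 /cpower ln1 !mulr0 expR0 cos0 sin0.
  by rewrite (_ : real_complex R 1 = 1)// (_ : Complex 1 0 = 1)// !mul1r.
have q0 : 0 < denq a by exact: denq_gt0.
have cop : coprimez (numq a) (denq a) by rewrite coprimezE coprime_num_den.
(* The Bezout coefficients of numerator and denominator give [r = u] and [s = - v]. *)
have [[u v] /= uv] := coprimezP _ _ cop.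
have det1 : numq a * u - denq a * (- v) = 1 by rewrite -uv; ring.
have [s1 [c1 [Htr Hfou c10]]] := hcusp _ (SL2Z_mx2 det1).
have [P1 P2] := part1 _ _ _ _ _ _ q0 det1 Htr Hfou.
have z0 : (0 : R) = - complex.Re (c 0) by rewrite c00 oppr0.
have z1 : (0 : R) = - complex.Im (c 0) by rewrite c00 oppr0.
split; first by rewrite z0; apply: P1; rewrite // c10.
by rewrite z1; apply: P2; rewrite // c10.
Qed.
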